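(* Let $P_1,\dots,P_m\subset\mathbb{R}^d$ be polytopes in general position. Then $$\mathrm{mComp}(P_1+\cdots+P_m)\ \ge\ \sum_{i=1}^m\mathrm{mComp}(P_i)+2\sum_{k=0}^{d-1}\binom{m-1}{k}-2m.$$ Equality holds if and only if all the $P_i$'s are line segments.
   Context: For a polytope $P$, $\mathrm{mComp}(P)$ is the number of vertices of $P$. $P_1+\cdots+P_m$ is the Minkowski sum. General position means generic: the vertices of the polytopes come from a probability distribution with continuous density, and the statement is understood to hold with probability one; in particular the codimension-one skeleta of the normal fans of the $P_i$ (the tropical hypersurfaces of the support functions $x\mapsto\max_{v\in P_i}\langle v,x\rangle$) intersect transversely away from their common base point.
   Formalization: ''Equality only if all P_i are segments'' is claimed only for m ≥ 2 and d ≠ 2: for m = 1 or d = 2 equality also holds for non-segments (e.g. triangle plus segment in the plane). Single-point polytopes are excluded, since the inequality can fail for them. *)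

(* Defs.v *)
From HB Require Import structures.
From mathcomp Require Import all_boot all_order all_algebra finmap.
From mathcomp Require Import all_classical all_reals all_analysis.

Set Implicit Arguments.
Unset Strict Implicit.
Unset Printing Implicit Defensive.

Import Order.TTheory GRing.Theory Num.Theory.
Import numFieldNormedType.Exports.

Local Open Scope classical_set_scope.
Local Open Scope ring_scope.

Section polytopes.
Context {R : realType} {d : nat}.
Implicit Types (v w y : 'rV[R]_d) (P : set 'rV[R]_d).

Definition dotv y v : R := \sum_(k < d) y ord0 k * v ord0 k.

Definition conv_hull (I : finType) (A : {set I}) (p : I -> 'rV[R]_d) :
    set 'rV[R]_d :=
  [set x | exists a : I -> R,
     [/\ forall j, j \in A -> 0 <= a j,
         \sum_(j in A) a j = 1
       & x = \sum_(j in A) a j *: p j] ].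

(* A vertex is a zero-dimensional face: the unique point of P at which some
   linear functional attains its maximum over P. *)
Definition vertices P : set 'rV[R]_d :=
  [set v | P v /\ exists y, forall w, P w -> w != v -> dotv y w < dotv y v].

(* [fset_set] returns the empty set on infinite sets; polytopes have finitely
   many vertices, so this convention is never used for them. *)
Definition mComp P : nat := #|` fset_set (vertices P)|.

Definition minkowski_sum (m : nat) (P : 'I_m -> set 'rV[R]_d) :
    set 'rV[R]_d :=
  [set x | exists2 p : 'I_m -> 'rV[R]_d,
     (forall i, P i (p i)) & x = \sum_(i < m) p i].

Definition line_segment P : Prop :=
  exists a b : 'rV[R]_d,
    a != b /\ P = [set (1 - t) *: a + t *: b | t in `[0, 1] ].

End polytopes.

(* The integral over R^n of a nonnegative Borel function with respect to
   Lebesgue measure, as an iterated one-dimensional integral (Tonelli). *)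
Fixpoint lebesgue_int (R : realType) (n : nat) :
    (n.-tuple (measurableTypeR R) -> \bar R) -> \bar R :=
  match n with
  | 0 => fun g => g [tuple]
  | n'.+1 => fun g =>
      (\int[@lebesgue_measure R]_x
         lebesgue_int (fun t => g [tuple of x :: t]))%E
  end.

(* R^n as a measurable space is [n.-tuple R] (product of the Borel
   sigma-algebras), as a topological space it is ['rV[R]_n]. *)
Definition has_continuous_density (R : realType) (n : nat)
    (mu : probability (n.-tuple (measurableTypeR R)) R) : Prop :=
  exists f : 'rV[R]_n -> R,
    [/\ continuous f,
        forall x, 0 <= f x
      & forall A : set (n.-tuple (measurableTypeR R)), measurable A ->
          mu A = lebesgue_int
                   (fun t => (f (\row_i tnth t i) * \1_A t)%:E)].

(* A point of R^(N * d) read as N points of R^d. *)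
Definition config_point (R : realType) (N d : nat)
    (t : (N * d).-tuple (measurableTypeR R)) (j : 'I_N) : 'rV[R]_d :=
  \row_k tnth t (mxvec_index j k).

(* The i-th polytope of a configuration: [c j] is the index of the polytope to
   which the j-th point belongs. *)
Definition config_polytope (R : realType) (N d m : nat) (c : 'I_N -> 'I_m)
    (t : (N * d).-tuple (measurableTypeR R)) (i : 'I_m) : set 'rV[R]_d :=
  conv_hull [set j | c j == i]%SET (config_point t).

(* Main.v *)
(* The vertices of P_1 + ... + P_m are the tuples (x_1, ..., x_m) of vertices
   that are simultaneously exposed by one linear functional y. Generically, if
   y <> 0 is maximal on P_i exactly at the vertices in F_i, then all tuples of
   \prod_i F_i occur, so every common point of the tropical hypersurfaces T_i
   with i in S (T_i is where the maximum on P_i is attained twice) yields a box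
   of tuples with two values in each direction of S.

   Lower bound, d >= 3. Fix an index m0 and an injective labelling g of the
   vertices. On the set of tuples, the monomials \prod_(i in S) g(x_i) with
   |S \ {m0}| < d and |S| <> 1, together with the functions of a single x_i, are
   linearly independent: alternating sums over the boxes separate them. There
   are 2 \sum_(k < d) C(m-1, k) sets S with |S \ {m0}| < d, and replacing the
   singletons by all functions of one coordinate accounts for the remaining
   terms. If some P_i has at least three vertices and m >= 2, boxes along two
   different edges of P_i exist and one more function is independent.

   The boxes exist by a maximum principle. If X is an intersection of T_i's
   that meets a cell of T_j but not T_j in a given half-space, then a ratio of
   two linear forms has a maximum on the part of X in that cell; but near any of
   its points X contains directions along which a generic linear form grows.

   For d = 2 every exposed vertex is sent to the tuple following its entry ray
   in the circular order. For segments, the opposite inequality is Pajor's form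
   of the Sauer-Shelah lemma. *)
Require Import Defs.
From HB Require Import structures.
From mathcomp Require Import all_boot all_order all_algebra finmap.
From mathcomp Require Import all_classical all_reals all_analysis.
From mathcomp Require Import measurable_realfun.
From mathcomp Require Import ring lra zify.

Set Implicit Arguments.
Unset Strict Implicit.
Unset Printing Implicit Defensive.

Import Order.TTheory GRing.Theory Num.Theory.
Import numFieldNormedType.Exports.

Local Open Scope ring_scope.

(** * Genericity *)

Section dot_product.
Context {R : realType} {d : nat}.
Implicit Types u v w y : 'rV[R]_d.

Lemma dotvC u v : dotv u v = dotv v u.
Proof. by apply: eq_bigr => k _; rewrite mulrC. Qed.

Lemma dotvDr u v w : dotv u (v + w) = dotv u v + dotv u w.
Proof. by rewrite -big_split; apply: eq_bigr => k _; rewrite mxE mulrDr. Qed.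

Lemma dotvZr a u v : dotv u (a *: v) = a * dotv u v.
Proof. by rewrite mulr_sumr; apply: eq_bigr => k _; rewrite mxE mulrCA. Qed.

Lemma dotv0 u : dotv u 0 = 0.
Proof. by apply: big1 => k _; rewrite mxE mulr0. Qed.

Lemma dotvNr u v : dotv u (- v) = - dotv u v.
Proof. by rewrite -scaleN1r dotvZr mulN1r. Qed.

Lemma dotvBr u v w : dotv u (v - w) = dotv u v - dotv u w.
Proof. by rewrite dotvDr dotvNr. Qed.

Lemma dotvDl u v w : dotv (u + v) w = dotv u w + dotv v w.
Proof. by rewrite dotvC dotvDr !(dotvC w). Qed.

Lemma dotvZl a u v : dotv (a *: u) v = a * dotv u v.
Proof. by rewrite dotvC dotvZr dotvC. Qed.

Lemma dotvNl u v : dotv (- u) v = - dotv u v.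
Proof. by rewrite dotvC dotvNr dotvC. Qed.

Lemma dot0v u : dotv 0 u = 0.
Proof. by rewrite dotvC dotv0. Qed.

Lemma dotv_sumr I (r : seq I) (P : pred I) u (F : I -> 'rV[R]_d) :
  dotv u (\sum_(i <- r | P i) F i) = \sum_(i <- r | P i) dotv u (F i).
Proof. by apply: (big_morph (dotv u)); [exact: dotvDr | exact: dotv0]. Qed.

Lemma dotv_gt0 u : u != 0 -> 0 < dotv u u.
Proof.
move=> u0; rewrite lt_neqAle sumr_ge0 ?andbT; last first.
  by move=> k _; rewrite -expr2 sqr_ge0.
apply: contraNneq u0 => e; apply/eqP/rowP => k; rewrite mxE.
have /psumr_eq0P/(_ k isT)/eqP := esym e; rewrite mulf_eq0 orbb => h.
by apply/eqP/h => i _; rewrite -expr2 sqr_ge0.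
Qed.

Lemma mulmx_tr_dotv n (A : 'M[R]_(n, d)) u i :
  (A *m u^T) i ord0 = dotv u (row i A).
Proof. by rewrite mxE /dotv; apply: eq_bigr => k _; rewrite !mxE mulrC. Qed.

End dot_product.

Section general_position.
Context {R : realType} {d N : nat}.
Implicit Types (p : 'I_N -> 'rV[R]_d) (E B : {set 'I_N}) (r : 'I_N -> 'I_N).

Definition edge_mx p E r : 'M[R]_(#|E|, d) :=
  \matrix_(i < #|E|) (p (enum_val i) - p (r (enum_val i))).

(* The edges join the points of [E] to points outside [E]; such forests of
   stars are the only ones needed. *)
Definition generic p : Prop := forall E r,
  (forall a, a \in E -> r a \notin E) -> (#|E| <= d)%N ->
  row_free (edge_mx p E r).

Lemma row_edge_mx p E r i :
  row i (edge_mx p E r) = p (enum_val i) - p (r (enum_val i)).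
Proof. by rewrite rowK. Qed.

Lemma mul_edge_mx p E r (k : 'I_N -> R) :
  (\row_(i < #|E|) k (enum_val i)) *m edge_mx p E r =
  \sum_(a in E) k a *: (p a - p (r a)).
Proof.
rewrite mulmx_sum_row [RHS]big_enum_val /=.
by apply: eq_bigr => i _; rewrite row_edge_mx mxE.
Qed.

Variables (p : 'I_N -> 'rV[R]_d) (gen : generic p).

Lemma generic_indep E r (k : 'I_N -> R) :
  (forall a, a \in E -> r a \notin E) -> (#|E| <= d)%N ->
  \sum_(a in E) k a *: (p a - p (r a)) = 0 -> forall a, a \in E -> k a = 0.
Proof.
move=> rE Ed; rewrite -mul_edge_mx => /eqP.
rewrite mulmx_free_eq0 ?gen // => /eqP /rowP h a aE.
by have := h (enum_rank_in aE a); rewrite !mxE enum_rankK_in.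
Qed.

(** Only the zero vector annihilates [d] independent edges. This bounds the number of simultaneous
    ties at a nonzero [y]. *)
Lemma generic_ortho_card E r y :
  (forall a, a \in E -> r a \notin E) -> y != 0 ->
  (forall a, a \in E -> dotv y (p a - p (r a)) = 0) -> (#|E| < d)%N.
Proof.
move=> rE y0 yE; rewrite ltnNge; apply/negP => dE.
(* Cutting [E] down to exactly [d] edges keeps it a forest of stars and makes the edge matrix square
   of full rank. *)
pose E' := [set a in take d (enum E)].
have E'E a : a \in E' -> a \in E by rewrite inE => /mem_take; rewrite mem_enum.
have cE' : #|E'| = d.
  by rewrite cardsE; move/card_uniqP: (take_uniq d (enum_uniq (mem E))) => ->;
     rewrite size_takel // -cardE.
have rE' a : a \in E' -> r a \notin E'.
  by move=> aE; apply: contra (rE a (E'E a aE)) => /E'E.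
have full : row_full (edge_mx p E' r).
  by rewrite /row_full; have /eqP -> := gen rE' (eq_leq cE'); rewrite cE'.
have [B BA] := row_fullP full.
case/eqP: y0; apply: trmx_inj; rewrite trmx0 -[y^T]mul1mx -BA -mulmxA.
have -> : edge_mx p E' r *m y^T = 0; last by rewrite mulmx0.
apply/matrixP => i j; rewrite (ord1 j) mulmx_tr_dotv row_edge_mx mxE.
by apply: yE; apply: E'E; apply: enum_valP.
Qed.

(** A right inverse of the edge matrix provides [u]. Perturbing a functional along such a [u] breaks
    ties in any prescribed way. *)
Lemma generic_target E r (tau : 'I_N -> R) :
  (forall a, a \in E -> r a \notin E) -> (#|E| <= d)%N ->
  exists u, forall a, a \in E -> dotv u (p a - p (r a)) = tau a.
Proof.
move=> rE Ed; have /row_freeP [B AB] := gen rE Ed.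
exists (B *m (\col_i tau (enum_val i)))^T => a aE.
have := mulmx_tr_dotv (edge_mx p E r) (B *m (\col_i tau (enum_val i)))^T
  (enum_rank_in aE a).
rewrite trmxK mulmxA AB mul1mx mxE row_edge_mx enum_rankK_in //.
Qed.

(** A subspace is its own double annihilator. The inequality suffices because the annihilator is
    closed under negation. *)
Lemma span_of_annihilator E r psi :
  (forall u, (forall a, a \in E -> dotv u (p a - p (r a)) = 0) ->
     dotv u psi <= 0) ->
  exists k : 'I_N -> R, psi = \sum_(a in E) k a *: (p a - p (r a)).
Proof.
move=> h; have : (psi <= edge_mx p E r)%MS.
  rewrite submxE; apply/eqP/rowP => j.
  pose u := (col j (cokermx (edge_mx p E r)))^T.
  have uE a : a \in E -> dotv u (p a - p (r a)) = 0.
    move=> aE; have := mulmx_tr_dotv (edge_mx p E r) u (enum_rank_in aE a).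
    rewrite trmxK row_edge_mx enum_rankK_in // => <-.
    by rewrite colE mulmxA mulmx_coker mul0mx mxE.
  have -> : (psi *m cokermx (edge_mx p E r)) ord0 j = dotv u psi.
    by rewrite mxE dotvC; apply: eq_bigr => k _; rewrite !mxE.
  rewrite mxE; apply/eqP; rewrite eq_le h //= -oppr_le0 -dotvNl h // => a aE.
  by rewrite dotvNl uE ?oppr0.
case/submxP => D ->.
(* The entries of [D] are indexed by positions in [enum E]; off [E] the coefficient is 0. *)
exists (fun a => if insub (index a (enum E)) is Some i then D ord0 i else 0).
rewrite mulmx_sum_row [RHS]big_enum_val /=; apply: eq_bigr => i _.
rewrite row_edge_mx; congr (_ *: _).
have h' : index (enum_val i) (enum E) = i.
  by rewrite /enum_val index_uniq ?enum_uniq // -cardE ltn_ord.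
by rewrite h' valK.
Qed.

Lemma generic_inj : (0 < d)%N -> injective p.
Proof.
move=> d0 a b pab; apply/eqP; apply: contraTT isT => ab.
have rE x : x \in [set a] -> b \notin [set a].
  by move=> _; rewrite inE eq_sym.
have : 1 = 0 :> R.
  apply: (generic_indep (k := fun=> 1) rE _ _ (set11 a)); first by rewrite cards1.
  by rewrite big_set1 pab subrr scaler0.
by move/eqP; rewrite oner_eq0.
Qed.

End general_position.

(** * Maximizers of a linear functional *)

Section maximizers.
Local Open Scope classical_set_scope.
Context {R : realType} {d N : nat}.
Variable p : 'I_N -> 'rV[R]_d.
Implicit Types (u y : 'rV[R]_d) (B : {set 'I_N}).

Definition top B y : {set 'I_N} :=
  [set a in B | [forall b in B, dotv y (p b) <= dotv y (p a)]]%SET.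

Lemma topP B y a :
  reflect (a \in B /\ forall b, b \in B -> dotv y (p b) <= dotv y (p a))
          (a \in top B y).
Proof.
rewrite inE; apply: (iffP andP) => [[aB /forall_inP h] | [aB h]]; split=> //.
exact/forall_inP.
Qed.

Lemma top_sub B y : top B y \subset B.
Proof. by apply/fintype.subsetP => a /topP []. Qed.

Lemma top_eq B y a b : a \in top B y -> b \in top B y ->
  dotv y (p a) = dotv y (p b).
Proof.
by move=> /topP [aB ha] /topP [bB hb]; apply/eqP; rewrite eq_le ha ?hb.
Qed.

Lemma top_lt B y a b : a \in top B y -> b \in B -> b \notin top B y ->
  dotv y (p b) < dotv y (p a).
Proof.
move=> /topP [aB ha] bB; rewrite ltNge; apply: contra => h.
by apply/topP; split=> // x xB; apply: le_trans h; apply: ha.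
Qed.

Lemma top_witness B y a : a \in B -> exists b, b \in top B y.
Proof.
move=> aB; case: (arg_maxP (fun x => dotv y (p x)) aB) => b bB h.
by exists b; apply/topP; split=> // x /h.
Qed.

Lemma top1P B y a :
  top B y = [set a]%SET <->
  a \in B /\ forall b, b \in B -> b != a -> dotv y (p b) < dotv y (p a).
Proof.
split=> [e | [aB h]].
  have ha : a \in top B y by rewrite e set11.
  split=> [|b bB ba]; first by case/topP: ha.
  by apply: (top_lt ha) => //; rewrite e inE.
apply/setP => b; rewrite !inE; apply/andP/eqP => [[bB /forall_inP hb] | ->].
  by apply: contraTeq (hb _ aB) => ba; rewrite -ltNge h.
split=> //; apply/forall_inP => x xB; have [-> //|xa] := eqVneq x a.
exact/ltW/h.
Qed.

Lemma near_right_pos (a b : R) : 0 < a -> \forall e \near 0^'+, 0 < a + e * b.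
Proof.
move=> a0; have b0 : 0 < `|b| + 1 by rewrite ltr_pwDr.
near=> e; have e0 : 0 < e by near: e; exact: nbhs_right_gt.
have ea : e < a / (`|b| + 1) by near: e; apply: nbhs_right_lt; rewrite divr_gt0.
have : `|e * b| < a.
  rewrite normrM gtr0_norm //; apply: le_lt_trans (_ : e * (`|b| + 1) < a).
    by rewrite ler_pM2l // lerDl.
  by rewrite -ltr_pdivlMr.
by rewrite ltr_norml => /andP [h _]; lra.
Unshelve. all: by end_near.
Qed.

(** Strict inequalities for [y] survive a small perturbation, and the ties of [y] are decided by
    [u]. One bound on [e] serves all [B] because only finitely many pairs of points are compared. *)
Lemma top_perturb y u :
  \forall e \near 0^'+, forall B, top B (y + e *: u) = top (top B y) u.
Proof.
have : \forall e \near 0^'+, forall ab : 'I_N * 'I_N,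
    dotv y (p ab.2) < dotv y (p ab.1) ->
    dotv (y + e *: u) (p ab.2) < dotv (y + e *: u) (p ab.1).
  apply: filter_forall => -[a b] /=.
  have [h|h] := boolP (dotv y (p b) < dotv y (p a)); last first.
    exact: filterE.
  rewrite -subr_gt0 in h.
  apply: filterS (near_right_pos (dotv u (p a) - dotv u (p b)) h).
  by move=> e he _; rewrite -subr_gt0 !dotvDl !dotvZl; lra.
move=> near1; near=> e => B.
have e0 : 0 < e by near: e; exact: nbhs_right_gt.
have hab a b : dotv y (p b) < dotv y (p a) ->
    dotv (y + e *: u) (p b) < dotv (y + e *: u) (p a).
  exact: (near near1 e _ (a, b)).
apply/setP => a; apply/topP/topP => -[aB ha].
  have at_ : a \in top B y.
    apply/topP; split=> // b /ha; rewrite !leNgt; apply: contra; exact: hab.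
  split=> // b bt; have := ha b (fintype.subsetP (top_sub B y) b bt).
  by rewrite !dotvDl !dotvZl (top_eq at_ bt) lerD2l ler_pM2l.
split=> [|b bB]; first exact: (fintype.subsetP (top_sub B y)).
have [bt|bt] := boolP (b \in top B y).
  by rewrite !dotvDl !dotvZl (top_eq aB bt) lerD2l ler_pM2l // ha.
exact/ltW/hab/(top_lt aB bB bt).
Unshelve. all: by end_near.
Qed.

Lemma dotv_continuous (v : 'rV[R]_d) : continuous (fun y : 'rV[R]_d => dotv y v).
Proof.
rewrite /dotv; apply: continuous_big => [|k _].
  by move=> x; apply: add_continuous.
by move=> y; apply: continuousM; [exact: coord_continuous | exact: cst_continuous].
Qed.

(** Strict inequalities persist nearby, so faces can only shrink. Closedness of tie conditions and
    the local constancy in [chain_const] rest on this. *)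
Lemma top_near y : \forall z \near y, forall B, top B z \subset top B y.
Proof.
have : \forall z \near y, forall ab : 'I_N * 'I_N,
    dotv y (p ab.2) < dotv y (p ab.1) -> dotv z (p ab.2) < dotv z (p ab.1).
  apply: (@filter_forall _ _ _ (nbhs y)) => -[a b] /=.
  have [h|h] := boolP (dotv y (p b) < dotv y (p a)); last first.
    exact: filterE.
  have : 0 < dotv y (p a - p b) by rewrite dotvBr subr_gt0.
  move=> /(cvgr_gt _ (@dotv_continuous (p a - p b) y)).
  by apply: filterS => z; rewrite dotvBr subr_gt0.
apply: filterS => z hz B; apply/fintype.subsetP => a /topP [aB ha].
apply/topP; split=> // b /ha; rewrite !leNgt; apply: contra.
exact: (hz (_, _)).
Qed.

End maximizers.

(** * Maximum of a ratio of linear forms on a closed cone *)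

Section cone_maximum.
Context {R : realType} {d : nat}.
Local Open Scope classical_set_scope.

(** The ratio of [l] to [f] is invariant under positive scaling, so it has a maximum on the compact
    slice of norm one. The conclusion is this maximality, cross-multiplied. *)
Lemma cone_ratio_max (C : set 'rV[R]_d) (l f z0 : 'rV[R]_d) :
  closed C -> (forall (s : R) y, 0 < s -> C y -> C (s *: y)) ->
  (forall y, C y -> y != 0 -> 0 < dotv f y) -> C z0 -> z0 != 0 ->
  exists y, [/\ C y, y != 0 &
    forall z, C z -> z != 0 -> dotv l z * dotv f y <= dotv l y * dotv f z].
Proof.
move=> Ccl Ccone fpos Cz0 z00.
pose K : set 'rV[R]_d := C `&` [set y | `|y| = 1].
have scaleK z : C z -> z != 0 -> K (`|z|^-1 *: z).
  move=> Cz z1; split; first by apply: Ccone => //; rewrite invr_gt0 normr_gt0.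
  by rewrite /= normrZ normrV ?unitfE ?normr_eq0 // normr_id mulVf // normr_eq0.
have K0 y : K y -> y != 0.
  by move=> [_ /= h]; rewrite -normr_eq0 h oner_eq0.
have Kcompact : compact K.
  apply: bounded_closed_compact.
    by exists 1; split=> // M M1 y [_ /= ->]; apply: ltW.
  apply: closedI => //.
  rewrite (_ : [set _ | _] = (fun y : 'rV[R]_d => `|y|) @^-1` [set 1]) //.
  by apply: preimage_closed; [move=> x _; exact: norm_continuous | exact: closed_eq].
have [||y yK hy] := @compact_EVT_max _ R (fun y => dotv l y / dotv f y) K _ Kcompact.
- by exists (`|z0|^-1 *: z0); exact: scaleK.
- apply: continuous_in_subspaceT => y; rewrite inE => yK.
  have cont v : {for y, continuous (dotv v : 'rV[R]_d -> R)}.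
    rewrite (_ : dotv v = dotv^~ v); first exact: dotv_continuous.
    by apply/funext => x; rewrite dotvC.
  apply: continuousM; first exact: cont.
  by apply: continuousV; [rewrite gt_eqF // fpos //; [case: yK | exact: K0] | exact: cont].
rewrite inE in yK; exists y; split; [by case: yK|exact: K0|] => z Cz z1.
have := hy (`|z|^-1 *: z); rewrite inE => /(_ (scaleK z Cz z1)).
have nz : 0 < `|z|^-1 by rewrite invr_gt0 normr_gt0.
rewrite !dotvZr -mulf_div divff ?mul1r ?gt_eqF // => h.
have fy : 0 < dotv f y by apply: fpos; [case: yK | exact: K0].
have fz := fpos z Cz z1.
by rewrite ler_pdivlMr // mulrAC ler_pdivrMr // in h.
Qed.

End cone_maximum.

(** * Common points of tropical hypersurfaces *)

Section ties.
Context {R : realType} {d N m : nat}.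
Variables (p : 'I_N -> 'rV[R]_d) (c : 'I_N -> 'I_m) (gen : generic p).
Implicit Types (S : {set 'I_m}) (F : 'I_m -> {set 'I_N}) (y u : 'rV[R]_d).

Local Notation cls i := [set j | c j == i]%SET.

(** The tied points not selected by [x] are the leaves of a forest of stars with fewer than [d]
    edges, so one direction lowers all of them relative to the selected ones. Hence every tuple in
    the product of the faces at [y] is exposed. *)
Lemma cells_at (x : 'I_m -> 'I_N) y : y != 0 ->
  (forall i, x i \in top p (cls i) y) ->
  exists z, forall i, top p (cls i) z = [set x i]%SET.
Proof.
move=> y0 xt; have cx i : c (x i) = i.
  by have /(fintype.subsetP (top_sub _ _ _)) := xt i; rewrite inE => /eqP.
pose E := [set a | (a \in top p (cls (c a)) y) && (a != x (c a))]%SET.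
have rE a : a \in E -> x (c a) \notin E by move=> _; rewrite inE cx eqxx andbF.
have Ed : (#|E| < d)%N.
  apply: (generic_ortho_card gen rE y0) => a; rewrite inE => /andP [at_ _].
  by rewrite dotvBr (top_eq at_ (xt (c a))) subrr.
have [u hu] := generic_target gen (fun=> -1) rE (ltnW Ed).
near (@at_right R 0) => e.
exists (y + e *: u) => i.
rewrite (near (top_perturb p y u) e) //; apply/top1P; split=> // b bt bx.
have cb : c b = i.
  by have /(fintype.subsetP (top_sub _ _ _)) := bt; rewrite inE => /eqP.
have := hu b; rewrite inE cb bt bx dotvBr => /(_ isT) h.
by rewrite -subr_lt0 h ltrN10.
Unshelve. all: by end_near.
Qed.

(* A move [u] keeps a tie in every [F i], [i \in S]. Lowering a single point of
   some [F i] with at least three points is a move, so only the two-point [F i]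
   can contribute to [psi]. *)
Lemma edge_span_of_moves S F y psi (a0 : 'I_N) : y != 0 ->
  (forall i, F i \subset cls i) -> (forall i, i \in S -> 1 < #|F i|)%N ->
  (forall i, i \in S -> {in F i &, forall a b, dotv y (p a) = dotv y (p b)}) ->
  (forall u, (forall i, i \in S -> 1 < #|top p (F i) u|)%N ->
     dotv u psi <= 0) ->
  exists v w : 'I_m -> 'I_N, exists t : 'I_m -> R,
    (forall i, i \in S -> [/\ v i \in F i, w i \in F i & v i != w i]) /\
    psi = \sum_(i in S) t i *: (p (v i) - p (w i)).
Proof.
move=> y0 FS F1 Fy Fpsi.
have cF i a : a \in F i -> c a = i.
  by move=> /(fintype.subsetP (FS i)); rewrite inE => /eqP.
have /choice [vw hvw] : forall i, exists z : 'I_N * 'I_N, i \in S ->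
    [/\ z.1 \in F i, z.2 \in F i & z.1 != z.2].
  move=> i; have [iS|_] := boolP (i \in S); last by exists (a0, a0).
  by have /card_gt1P [v [w h]] := F1 i iS; exists (v, w).
pose v i := (vw i).1; pose w i := (vw i).2.
(* One star per [F i], centred at [w i], with the other tied points as leaves. *)
pose E := [set a | [&& c a \in S, a \in F (c a) & a != w (c a)]]%SET.
have cw i : i \in S -> c (w i) = i by case/hvw => _ /cF.
have rE a : a \in E -> w (c a) \notin E.
  by rewrite !inE => /and3P [aS _ _]; rewrite cw // eqxx !andbF.
have Ed : (#|E| < d)%N.
  apply: (generic_ortho_card gen rE y0) => a; rewrite inE => /and3P [aS aF _].
  by have [_ wF _] := hvw _ aS; rewrite dotvBr (Fy _ aS a _ aF wF) subrr.
have wE i : i \in S -> w i \notin E.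
  by move=> iS; rewrite inE cw // eqxx !andbF.
(* [tau] gives the heights of the leaves over their centres. If the greatest height in each [F i] is
   reached on a set [G] of at least two points, then [u] is a move. *)
have ties u (tau : 'I_N -> R) :
    (forall a, a \in E -> dotv u (p a - p (w (c a))) = tau a) ->
    (forall a, a \notin E -> tau a = 0) ->
    (forall i, i \in S -> exists G : {set 'I_N}, [/\ G \subset F i, (1 < #|G|)%N &
       forall a b, a \in G -> b \in F i -> tau b <= tau a]) ->
    dotv u psi <= 0.
  move=> hu tau0 hG; apply: Fpsi => i iS; have [G [GF G1 Gmax]] := hG i iS.
  have uF a : a \in F i -> dotv u (p a) = dotv u (p (w i)) + tau a.
    move=> aF; have [aE|aE] := boolP (a \in E).
      by rewrite -(hu a aE) dotvBr (cF i a aF) addrC subrK.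
    rewrite tau0 // addr0; move: aE; rewrite inE (cF i a aF) iS aF /=.
    by rewrite negbK => /eqP ->.
  apply: (leq_trans G1); apply: subset_leq_card; apply/fintype.subsetP => a aG.
  apply/topP; split=> [|b bF]; first exact: (fintype.subsetP GF).
  by rewrite (uF b bF) (uF a) ?(fintype.subsetP GF) // lerD2l Gmax.
(* A vector orthogonal to all edges of the stars keeps every tie, so it is a move. *)
have [k kpsi] : exists k : 'I_N -> R,
    psi = \sum_(a in E) k a *: (p a - p (w (c a))).
  apply: span_of_annihilator => u hu.
  apply: (ties u (fun=> 0)) => // i iS; exists (F i); split=> //; exact: F1.
have tiesk (tau : 'I_N -> R) : (forall a, a \notin E -> tau a = 0) ->
    (forall i, i \in S -> exists G : {set 'I_N}, [/\ G \subset F i, (1 < #|G|)%N &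
       forall a b, a \in G -> b \in F i -> tau b <= tau a]) ->
    \sum_(a in E) k a * tau a <= 0.
  move=> tau0 hG; have [u hu] := generic_target gen tau rE (ltnW Ed).
  have := ties u tau hu tau0 hG; rewrite kpsi dotv_sumr.
  by under eq_bigr => a aE do rewrite dotvZr hu //.
have k0 i : i \in S -> (2 < #|F i|)%N -> forall a, a \in E -> c a = i -> k a = 0.
  move=> iS Fi.
  have cD a : (1 < #|F i :\ a|)%N.
    by have := cardsD1 a (F i); case: (a \in F i) => /= e;
      rewrite e ?add1n ?add0n in Fi; [rewrite ltnS in Fi | exact: ltnW].
  (* Lowering [a] alone leaves at least two points of [F i] tied on top. *)
  have kge0 a : a \in E -> c a = i -> 0 <= k a.
    move=> aE ca; rewrite -oppr_le0.
    have := tiesk (fun b => - (b == a)%:R) _ _.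
    rewrite (big_rem a) /=; last first.
      by rewrite mem_index_enum.
    rewrite aE eqxx mulrN1 big1_seq ?addr0; last first.
      move=> b /andP [_]; rewrite mem_rem_uniq ?index_enum_uniq // inE.
      case/andP => [/negPf -> _].
      by rewrite oppr0 mulr0.
    apply=> [b bE|j jS].
      by rewrite (negPf (_ : b != a)) ?oppr0 //; apply: contraNneq bE => ->.
    exists (F j :\ a); split=> [||b b']; first exact: subsetDl.
      have [-> //|ji] := eqVneq j i.
      rewrite (_ : F j :\ a = F j) ?F1 //; apply/finset.setDidPl.
      rewrite disjoint_sym disjoints1; apply: contra ji => /cF <-; exact/eqP.
    by rewrite !inE => /andP [/negPf -> _] _; rewrite oppr0 oppr_le0 ler0n.
  (* Raising every point of [F i] except the centre also leaves at least two points on top.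
     Nonnegative coefficients with nonpositive sum vanish. *)
  have ksum : \sum_(a in E | c a == i) k a <= 0.
    have := tiesk (fun b => ((b \in E) && (c b == i))%:R) _ _.
    rewrite big_mkcondr /=.
    under eq_bigr => a aE do rewrite aE /= mulr_natr mulrb.
    apply=> [b /negPf -> //|j jS]; have [-> |ji] := eqVneq j i.
      exists (F i :\ w i); split=> //; first exact: subsetDl.
      move=> b b'; rewrite !inE => /andP [bw bF] _.
      by rewrite (cF _ _ bF) iS bF bw eqxx lern1 leq_b1.
    exists (F j); split; [by [] | exact: F1 | move=> b b' bF b'F].
    by rewrite (cF _ _ bF) (cF _ _ b'F) (negPf ji) !andbF.
  have : \sum_(a in E | c a == i) k a = 0.
    apply/eqP; rewrite eq_le ksum sumr_ge0 // => a /andP [aE /eqP ca].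
    exact: kge0.
  move=> /psumr_eq0P h a aE ca; apply: h; last by rewrite aE ca /=.
  by move=> b /andP [bE /eqP cb]; exact: kge0.
(* In a two-point [F i] the only leaf is [v i]; for a larger one the coefficient is zero and any
   pair serves. *)
exists v, w, (fun i => if (2 < #|F i|)%N then 0 else k (v i)); split=> //.
rewrite kpsi (partition_big c (mem S)) /=; last by move=> a; rewrite inE => /and3P [].
apply: eq_bigr => i iS; have [vF wF vw_] := hvw i iS; case: ifPn => Fi.
  rewrite scale0r big1 // => a /andP [aE /eqP ca].
  by rewrite (k0 i) // scale0r.
rewrite (big_pred1 (v i)) ?(cF i _ vF) // => a /=; rewrite inE.
have [->|av] := eqVneq a (v i); first by rewrite (cF i _ vF) iS vF eqxx vw_.
apply/negbTE; apply: contra Fi => /andP [/and3P [_ aF aw] /eqP ca].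
rewrite ca in aF aw.
apply: leq_trans (_ : #|[set v i; w i; a]%SET| <= _)%N.
  by rewrite finset.setUC cardsU1 cards2 vw_ !inE negb_or av aw.
apply: subset_leq_card; apply/fintype.subsetP => b.
by rewrite !inE => /orP [/orP [] |] /eqP ->.
Qed.

End ties.

Section tie_points.
Context {R : realType} {d N m : nat}.
Variables (p : 'I_N -> 'rV[R]_d) (c : 'I_N -> 'I_m) (gen : generic p).
Implicit Types (S : {set 'I_m}) (B : 'I_m -> {set 'I_N}) (y u l : 'rV[R]_d).
Local Open Scope classical_set_scope.

Local Notation cls i := [set j | c j == i]%SET.

(** The nondegeneracy carried through the induction of [tie_point]; for empty [S] it says that [l]
    is nonzero. *)
Definition edge_free S B l : Prop :=
  forall (v w : 'I_m -> 'I_N) (t : 'I_m -> R),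
    (forall i, i \in S -> [/\ v i \in B i, w i \in B i & v i != w i]) ->
    l != \sum_(i in S) t i *: (p (v i) - p (w i)).

Lemma closed_ties S B :
  closed [set y | forall i, i \in S -> (1 < #|top p (B i) y|)%N].
Proof.
rewrite closedE => y; apply: contra_notP => /existsNP [i /not_implyP [iS /negP h]].
apply: filterS (top_near p y) => z hz /(_ i iS) h'.
by move: h; rewrite (leq_trans h') // subset_leq_card.
Qed.

Lemma closed_top (F : {set 'I_N}) a : closed [set y | a \in top p F y].
Proof.
rewrite closedE => y; apply: contra_notP => /negP h.
apply: filterS (top_near p y) => z hz h'.
by move: h; rewrite (fintype.subsetP (hz F)).
Qed.

Lemma closed_dotv_le0 l : closed [set y | dotv l y <= 0].
Proof.
rewrite (_ : [set _ | _] = (fun y => dotv y l) @^-1` [set x : R | x <= 0]).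
  by apply: preimage_closed; [move=> x _; exact: dotv_continuous | exact: closed_le].
by apply/seteqP; split=> y /=; rewrite dotvC.
Qed.

Lemma topZ (F : {set 'I_N}) (s : R) y : 0 < s -> top p F (s *: y) = top p F y.
Proof.
move=> s0; apply/setP => a; apply/topP/topP => -[aF h]; split=> // b /h.
  by rewrite !dotvZl ler_pM2l.
by rewrite !dotvZl ler_pM2l.
Qed.

(* The maximum principle: at a maximum of the ratio of [- l] to an edge of
   [B j], a combination of these two vectors is nonpositive on all moves. *)
Lemma tie_point S B l (a0 : 'I_N) :
  (forall i, B i \subset cls i) -> (forall i, i \in S -> 1 < #|B i|)%N ->
  edge_free S B l ->
  exists y, [/\ y != 0, forall i, i \in S -> (1 < #|top p (B i) y|)%N &
                dotv l y <= 0].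
Proof.
move=> Bc; have [n] := ubnP #|S|; elim: n S l => // n IHn S l Sn B1 lfree.
have [S0|[j jS]] := set_0Vmem S.
  have /eqP l0 : l != 0.
    have := lfree (fun=> a0) (fun=> a0) (fun=> 0); rewrite S0 big_set0; apply=> i.
    by rewrite inE.
  exists (- l); split=> [|i|]; first by rewrite oppr_eq0; exact/eqP.
    by rewrite S0 inE.
  by rewrite dotvNr oppr_le0 ltW // dotv_gt0 //; exact/eqP.
have /card_gt1P [vj [wj [vjB wjB vwj]]] := B1 j jS.
pose S' := (S :\ j)%SET.
have S'S i : i \in S' -> i \in S by rewrite inE => /andP [].
(* Edge-freeness over [S], with the edge of [B j] split off from those over [S']. *)
have extend (v w : 'I_m -> 'I_N) t v1 w1 t1 : v1 \in B j -> w1 \in B j -> v1 != w1 ->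
    (forall i, i \in S' -> [/\ v i \in B i, w i \in B i & v i != w i]) ->
    l != t1 *: (p v1 - p w1) + \sum_(i in S') t i *: (p (v i) - p (w i)).
  move=> v1B w1B vw1 hvw.
  have := lfree (fun i => if i == j then v1 else v i) (fun i => if i == j then w1 else w i)
    (fun i => if i == j then t1 else t i) _.
  rewrite (big_setD1 j) //= eqxx (eq_bigr (fun i => t i *: (p (v i) - p (w i)))).
    apply=> i iS; case: (eqVneq i j) => [->|ij]; first by [].
    by apply: hvw; rewrite !inE ij.
  by move=> i; rewrite !inE => /andP [/negPf ->].
have [||y1 [y10 y1S y1l]] := IHn S' l _ (fun i iS => B1 i (S'S i iS)).
- by move: Sn; rewrite (cardsD1 j) jS.
- by move=> v w t hvw; have := extend v w t _ _ 0 vjB wjB vwj hvw; rewrite scale0r add0r.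
apply: contrapT => none.
have noneS y : y != 0 -> (forall i, i \in S' -> (1 < #|top p (B i) y|)%N) ->
    dotv l y <= 0 -> (#|top p (B j) y| <= 1)%N.
  move=> y0 yS yl; rewrite leqNgt; apply/negP => yj; apply: none; exists y; split=> // i iS.
  by have [-> //|ij] := eqVneq i j; apply: yS; rewrite !inE ij.
have [v vtop] := top_witness p y1 vjB.
have vB : v \in B j := fintype.subsetP (top_sub p _ _) v vtop.
have [w wB vw] : exists2 w, w \in B j & v != w.
  by have [e|] := eqVneq v vj; [exists wj; rewrite ?e | exists vj].
(* If no common tie exists, [v] is the only maximizer on [B j] at each nonzero point of this cone,
   which makes [f] positive there. *)
pose C := [set y | forall i, i \in S' -> (1 < #|top p (B i) y|)%N] `&`
          ([set y | dotv l y <= 0] `&` [set y | v \in top p (B j) y]).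
have [f fE] : exists f, f = p v - p w by exists (p v - p w).
have topv y : C y -> y != 0 -> top p (B j) y = [set v]%SET.
  move=> [yS [yl yv]] y0; have := noneS y y0 yS yl; move/card_le1_eqP => h.
  by apply/setP => x; rewrite inE; apply/idP/eqP => [xt|->//]; exact: h.
have fpos y : C y -> y != 0 -> 0 < dotv f y.
  move=> Cy y0; have e := topv y Cy y0; case/top1P: e => _ /(_ w wB).
  by rewrite eq_sym vw => /(_ isT); rewrite fE -subr_gt0 -dotvBr dotvC.
have [||||y [Cy y0 ymax]] := @cone_ratio_max _ _ C (- l) f y1 _ _ fpos.
- apply: closedI; first exact: closed_ties.
  by apply: closedI; [exact: closed_dotv_le0 | exact: closed_top].
- move=> s y s0 [yS [yl yv]]; split; first by move=> i iS; rewrite topZ // yS.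
  by split; rewrite /= ?topZ // dotvZr mulr_ge0_le0 // ltW.
- by split.
- by [].
have fy := fpos y Cy y0; have [yS [yl yv]] := Cy.
(* Up to the positive factor [dotv f y ^+ 2], the gradient at [y] of the ratio of [- l] to [f]. *)
pose psi := dotv f y *: (- l) - dotv (- l) y *: f.
have [|||u Fu|v' [w' [t [hvw hpsi]]]] :=
    @edge_span_of_moves _ _ _ _ p c gen S' (fun i => top p (B i) y) y psi a0 y0.
- by move=> i; apply: fintype.subset_trans (Bc i); exact: top_sub.
- by move=> i /yS.
- by move=> i _ a b aF bF; exact: top_eq aF bF.
(* A move along which the ratio grows would, after a small step, stay in the cone and contradict
   maximality. *)
- rewrite leNgt; apply/negP => psi0.
  near (@at_right R 0) => e.
  have e0 : 0 < e by near: e; exact: nbhs_right_gt.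
  have topz := near (top_perturb p y u) e; set z := y + e *: u in topz.
  have zS i : i \in S' -> (1 < #|top p (B i) z|)%N.
    by move=> iS; rewrite topz // Fu.
  have zv : v \in top p (B j) z.
    rewrite topz // topv //; apply/topP; rewrite inE; split=> // b.
    by rewrite inE => /eqP ->.
  have fz : 0 <= dotv f z.
    rewrite fE dotvC dotvBr subr_ge0; by case/topP: zv => _; apply.
  have hz : dotv (- l) y * dotv f z < dotv f y * dotv (- l) z.
    rewrite -subr_gt0; have : 0 < e * dotv u psi by rewrite mulr_gt0.
    rewrite /psi /z !(dotvDr, dotvNr, dotvZr, dotvNl) (dotvC u l) (dotvC u f).
    by lra.
  (* The larger ratio forces [- l] to be positive at [z], so [z] is nonzero and stays in the
     half-space. *)
  have zl : dotv l z < 0.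
    rewrite -oppr_gt0 -dotvNl -(pmulr_rgt0 _ fy); apply: le_lt_trans hz.
    by rewrite mulr_ge0 // dotvNl oppr_ge0.
  have z0 : z != 0 by apply: contraTneq zl => ->; rewrite dotv0 ltxx.
  have Cz : C z by split=> //; split=> //; exact: ltW.
  by have := ymax z Cz z0; rewrite leNgt [X in _ < X]mulrC hz.
(* Solving the definition of [psi] for [l] writes it as a combination of [f] and edges over [S'],
   which [extend] excludes. *)
have := extend v' w' (fun i => - (dotv f y)^-1 * t i) v w
  (- (dotv f y)^-1 * dotv (- l) y) vB wB vw.
case/(_ _)/negP.
  move=> i iS; have [vt wt vw'] := hvw i iS.
  by split=> //; [apply: (fintype.subsetP (top_sub p (B i) y)).. ].
apply/eqP; under eq_bigr => i _ do rewrite -scalerA.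
rewrite -scaler_sumr -hpsi /psi -fE scalerBr !scalerA mulNr mulNr mulVf ?gt_eqF //.
by rewrite scaleN1r opprK addrC addrNK.
Unshelve. all: by end_near.
Qed.

End tie_points.

Section tie_existence.
Context {R : realType} {d N m : nat}.
Variables (p : 'I_N -> 'rV[R]_d) (c : 'I_N -> 'I_m) (gen : generic p).
Implicit Types (S : {set 'I_m}) (B : 'I_m -> {set 'I_N}) (y u l : 'rV[R]_d).

Local Notation cls i := [set j | c j == i]%SET.

(** A relation would make the edge from [a] to [b], together with one edge per class of [S], a
    dependent forest of at most [d] edges. *)
Lemma edge_free_edge S B a b : (forall i, B i \subset cls i) ->
  a != b -> (forall i, i \in S -> a \notin B i) -> (#|S| < d)%N ->
  edge_free p S B (p a - p b).
Proof.
move=> Bc ab aB Sd v w t hvw.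
have cB i x : x \in B i -> c x = i.
  by move=> /(fintype.subsetP (Bc i)); rewrite inE => /eqP.
(* Edges that start at [b] are reversed: [b] is the centre for [a], so it must not be a leaf. *)
pose v' i := if v i == b then w i else v i.
pose w' i := if v i == b then v i else w i.
pose t' i := if v i == b then - t i else t i.
have hvw' i : i \in S -> [/\ v' i \in B i, w' i \in B i, v' i != w' i & v' i != b].
  rewrite /v' /w' => /hvw [vB wB vw]; case: (eqVneq (v i) b) => [e|//].
  by rewrite vB wB -e eq_sym vw.
have tE i : t i *: (p (v i) - p (w i)) = t' i *: (p (v' i) - p (w' i)).
  by rewrite /t' /v' /w'; case: ifP => // _; rewrite scaleNr -scalerN opprB.
under eq_bigr => i _ do rewrite tE.
have cv' i : i \in S -> c (v' i) = i by case/hvw' => /cB.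
have v'inj : {in S &, injective v'}.
  by move=> i j iS jS e; rewrite -(cv' i) // e cv'.
pose E := (a |: [set v' i | i in S])%SET.
pose r x := if x == a then b else w' (c x).
have aV : a \notin [set v' i | i in S]%SET.
  apply/imsetP => -[i iS e]; have [vB _ _ _] := hvw' i iS.
  by have := aB i iS; rewrite e vB.
have rE x : x \in E -> r x \notin E.
  rewrite !inE /r => /orP [/eqP ->|/imsetP [i iS ->]].
    rewrite eqxx eq_sym (negPf ab) /=; apply/imsetP => -[i iS e].
    by have [_ _ _] := hvw' i iS; rewrite e eqxx.
  have [vB wB vw vb] := hvw' i iS.
  have va : v' i != a by apply: contraTneq vB => ->; exact: aB.
  rewrite (negPf va) cv' // negb_or; apply/andP; split.
    by apply: contraTneq wB => ->; exact: aB.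
  apply/imsetP => -[j jS e]; have := cB _ _ wB; rewrite e cv' // => ji.
  by rewrite e ji eqxx in vw.
have Ed : (#|E| <= d)%N.
  by rewrite cardsU1 aV add1n; apply: leq_ltn_trans Sd; exact: leq_imset_card.
apply/eqP => rel.
have := generic_indep gen (k := fun x => if x == a then 1 else - t' (c x)) rE Ed.
rewrite big_setU1 //= big_imset //= /r eqxx scale1r rel.
rewrite [X in _ + X](eq_bigr (fun i => - (t' i *: (p (v' i) - p (w' i))))); last first.
  move=> i iS; have [vB _ _ _] := hvw' i iS.
  have /negPf -> : v' i != a by apply: contraTneq vB => ->; exact: aB.
  by rewrite cv' // scaleNr.
rewrite sumrN subrr => /(_ erefl a); rewrite eqxx !inE eqxx => /(_ isT) /eqP.
by rewrite oner_eq0.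
Qed.

(** Delete [a] from its class and apply [tie_point] to [p a - p b] with [b] a remaining point. As
    [a] is then no higher than [b], maxima over the smaller class are maxima over the whole
    class. *)
Lemma ties_off_point S i a : i \in S -> a \in cls i -> (2 < #|cls i|)%N ->
  (forall j, 1 < #|cls j|)%N -> (#|S| < d)%N ->
  exists y, [/\ y != 0, forall j, j \in S -> (1 < #|top p (cls j) y|)%N &
                (1 < #|top p (cls i) y :\ a|)%N].
Proof.
move=> iS ac c2 c1 Sd.
pose B j := if j == i then (cls i :\ a)%SET else cls j.
have Bi : (1 < #|B i|)%N.
  by rewrite /B eqxx; move: c2; rewrite (cardsD1 a) ac add1n ltnS.
have [b bB] : exists b, b \in B i by apply/card_gt0P; exact: ltnW.
have BE j : B j \subset cls j.
  by rewrite /B; case: eqP => [->|_]; [exact: subD1set | exact: subxx].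
have ab : a != b by move: bB; rewrite /B eqxx !inE eq_sym => /andP [].
have bc : b \in cls i := fintype.subsetP (BE i) b bB.
have aB j : j \in S -> a \notin B j.
  move=> jS; rewrite /B; case: (eqVneq j i) => [_|ji]; first by rewrite !inE eqxx.
  by move: ac; rewrite !inE => /eqP ->; rewrite eq_sym.
have B1 j : j \in S -> (1 < #|B j|)%N.
  by move=> _; have [->|ji] := eqVneq j i; rewrite // /B (negPf ji).
have [y [y0 yS yl]] := tie_point gen a BE B1 (edge_free_edge BE ab aB Sd).
have ya : dotv y (p a) <= dotv y (p b).
  by rewrite -subr_le0 -dotvBr dotvC.
have sub : top p (B i) y \subset (top p (cls i) y :\ a)%SET.
  apply/fintype.subsetP => x /topP [xB hx].
  have xa : x != a by move: xB; rewrite /B eqxx !inE => /andP [].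
  rewrite in_setD1 xa; apply/topP; split=> [|z zc].
    exact: (fintype.subsetP (BE i)).
  have [->|za] := eqVneq z a; first by apply: le_trans ya _; exact: hx.
  by apply: hx; rewrite /B eqxx in_setD1 za.
exists y; split=> // [j jS|]; last first.
  by apply: leq_trans (yS i iS) _; exact: subset_leq_card.
have [->|ji] := eqVneq j i; last by have := yS j jS; rewrite /B (negPf ji).
apply: leq_trans (yS i iS) _; apply: subset_leq_card.
exact: fintype.subset_trans sub (subD1set _ _).
Qed.

(** Applying [tie_point] to [p v - p w] makes [w] at least as high as [v], so [v] is not the only
    maximizer. *)
Lemma ties_avoid S j v : j \notin S -> v \in cls j ->
  (forall i, 1 < #|cls i|)%N -> (#|S| < d)%N ->
  exists y, [/\ y != 0, forall i, i \in S -> (1 < #|top p (cls i) y|)%N &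
                exists2 w, w \in top p (cls j) y & w != v].
Proof.
move=> jS vc c1 Sd.
have [w wc wv] : exists2 w, w \in cls j & w != v.
  have /card_gt1P [x [z [xc zc xz]]] := c1 j.
  by have [e|] := eqVneq x v; [exists z; rewrite // -e eq_sym | exists x].
have vB i : i \in S -> v \notin cls i.
  by move: vc; rewrite !inE => /eqP -> iS; apply: contraNneq jS => ->.
have [|||y [y0 yS yl]] := @tie_point _ _ _ _ p c gen S (fun i => cls i) (p v - p w) v.
- by move=> i; exact: subxx.
- by move=> i _; exact: c1.
- by apply: edge_free_edge => //; rewrite eq_sym.
exists y; split=> //.
have [x xt] := top_witness p y vc.
have [xv|xv] := eqVneq x v; last by exists x.
exists w => //; apply/topP; split=> // z zc.
case/topP: xt => _ /(_ z zc); rewrite xv => /le_trans; apply.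
by rewrite -subr_le0 -dotvBr dotvC.
Qed.

Lemma orthogonal_vector (S : {set 'I_m}) (f : 'I_m -> 'rV[R]_d) :
  (#|S| < d)%N -> exists2 y, y != 0 & forall i, i \in S -> dotv y (f i) = 0.
Proof.
move=> Sd; pose A : 'M[R]_(#|S|, d) := \matrix_i f (enum_val i).
have : kermx A^T != 0.
  rewrite kermx_eq0; apply/negP => /eqP rk.
  by have := rank_leq_col A^T; rewrite rk leqNgt Sd.
move=> /rowV0Pn [y yk y0]; exists y => // i iS.
have /sub_kermxP/(congr1 trmx) := yk; rewrite trmx_mul trmxK trmx0 => h.
have := mulmx_tr_dotv A y (enum_rank_in iS i).
by rewrite h mxE rowK enum_rankK_in.
Qed.

(** A class of [S] with three points allows [ties_off_point]. If all classes of [S] are pairs, a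
    vector orthogonal to their fewer than [d] edges ties all of them. *)
Lemma ties_exist S : (forall i, 1 < #|cls i|)%N -> (#|S| < d)%N ->
  exists2 y, y != 0 & forall i, i \in S -> (1 < #|top p (cls i) y|)%N.
Proof.
move=> c1 Sd.
have [[i iS ci]|small] := pselect (exists2 i, i \in S & (2 < #|cls i|)%N).
  have /card_gt0P [a ac] : (0 < #|cls i|)%N by apply: ltnW.
  by have [y [y0 yS _]] := ties_off_point iS ac ci c1 Sd; exists y.
have /choice [vw hvw] : forall i, exists z : 'I_N * 'I_N,
    [/\ z.1 \in cls i, z.2 \in cls i & z.1 != z.2].
  by move=> i; have /card_gt1P [v [w h]] := c1 i; exists (v, w).
have [y y0 yS] := orthogonal_vector (fun i => p (vw i).1 - p (vw i).2) Sd.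
exists y => // i iS; have [v1 w1 vw1] := hvw i.
have ci : cls i = [set (vw i).1; (vw i).2]%SET.
  apply/esym/eqP; rewrite eqEcard cards2 vw1; apply/andP; split.
    by apply/fintype.subsetP => x; rewrite in_set2 => /orP [] /eqP ->.
  by rewrite leqNgt; apply/negP => h; apply: small; exists i.
have eqy : dotv y (p (vw i).1) = dotv y (p (vw i).2).
  by apply/eqP; rewrite -subr_eq0 -dotvBr yS.
apply: (leq_trans (c1 i)); apply: subset_leq_card.
apply/fintype.subsetP => a ac; apply/topP; split=> // b.
by move: ac; rewrite ci !in_set2 => /orP [] /eqP -> /orP [] /eqP ->; rewrite ?eqy.
Qed.

End tie_existence.

(** * Connecting exposed points through tied faces *)

Section chains.
Context {R : realType} {d N : nat}.
Variables (p : 'I_N -> 'rV[R]_d).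
Local Open Scope classical_set_scope.

(** On a segment of nonzero functionals from [ya] to [yb], the value of [h] at a maximizer is
    locally constant, since nearby faces lie inside the current one. The segment is connected. *)
Lemma chain_const (T : Type) (F : {set 'I_N}) (h : 'I_N -> T) ya yb a b :
  (1 < d)%N -> (1 < #|F|)%N ->
  (forall y, y != 0 -> {in top p F y &, forall a b, h a = h b}) ->
  top p F ya = [set a]%SET -> top p F yb = [set b]%SET -> h a = h b.
Proof.
move=> d1 F1 hh ta tb.
have ne0 y x : top p F y = [set x]%SET -> y != 0.
  move=> tx; apply/eqP => y0; move: F1; rewrite -(cards1 x) -tx.
  apply/negP; rewrite -leqNgt; apply: subset_leq_card.
  by apply/fintype.subsetP => z zF; apply/topP; split=> // w _; rewrite y0 !dot0v.
(* The segment avoids 0 when its ends are not parallel. Otherwise [ya] is first moved slightly along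
   a coordinate vector that is not a multiple of [yb]. *)
suff main y1 : top p F y1 = [set a]%SET -> (forall s, y1 != s *: yb) -> h a = h b.
  have [[s ys]|nos] := pselect (exists s, ya = s *: yb); last first.
    by apply: (main ya ta) => s; apply/eqP => e; apply: nos; exists s.
  have [k yk] : exists k, yb ord0 k != 0.
    apply: contrapT => no; case/eqP: (ne0 _ _ tb); apply/rowP => k; rewrite mxE.
    by apply: contrapT => /eqP yk; apply: no; exists k.
  have [k' kk'] : exists k', k' != k.
    have : (1 < #|'I_d|)%N by rewrite card_ord.
    by case/card_gt1P => x [z [_ _ xz]]; have [e|] := eqVneq x k;
      [exists z; rewrite -e eq_sym | exists x].
  pose w : 'rV[R]_d := delta_mx ord0 k'.
  have w0 s' : w != s' *: yb.
    apply/eqP => e; have := congr1 (fun M : 'rV[R]_d => M ord0 k) e.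
    rewrite !mxE eqxx eq_sym (negPf kk') /= => /esym/eqP.
    rewrite mulf_eq0 (negPf yk) orbF => /eqP s0.
    have := congr1 (fun M : 'rV[R]_d => M ord0 k') e.
    by rewrite s0 scale0r !mxE !eqxx => /eqP; rewrite oner_eq0.
  near (@at_right R 0) => e.
  have e0 : 0 < e by near: e; exact: nbhs_right_gt.
  apply: (main (ya + e *: w)).
    rewrite (near (top_perturb p ya w) e) // ta; apply/top1P; rewrite inE.
    by split=> // x; rewrite inE => ->.
  move=> s'; apply/negP => /eqP; rewrite ys => /(canRL (addKr _)) e'.
  have /negP := w0 (e^-1 * (s' - s)); apply; apply/eqP.
  by rewrite -scalerA scalerBl [s' *: _ - _]addrC -e' scalerA mulVf ?gt_eqF // scale1r.
move=> t1 nopar.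
pose y t : 'rV[R]_d := y1 + t *: (yb - y1).
have y0 t : y t != 0.
  apply/eqP; rewrite /y scalerBr addrA addrAC -{1}[y1]scale1r -scalerBl => e.
  have [t1'|t1'] := eqVneq t 1.
    by move: e (ne0 _ _ tb); rewrite t1' subrr scale0r add0r scale1r => ->; rewrite eqxx.
  have /eqP := nopar (- (1 - t)^-1 * t); apply.
  move/eqP: e; rewrite addr_eq0 => /eqP e.
  by rewrite mulNr scaleNr -scalerA -scalerN -e scalerA mulVf ?scale1r // subr_eq0 eq_sym.
have /choice [f hf] : forall t, exists x, x \in top p F (y t).
  by move=> t; have /card_gt0P [x xF] := ltnW F1; exact: top_witness xF.
have yc : continuous y.
  by move=> t; apply: cvgD; [exact: cvg_cst | exact: scalel_continuous].
have loc t : \forall s \near t, h (f s) = h (f t).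
  have yt : \forall s \near t, forall B, top p B (y s) \subset top p B (y t).
    exact: (yc t _ (top_near p (y t))).
  near=> s; apply: (hh (y t)) => //.
  by apply: (fintype.subsetP (near yt s _ F)).
have op (P : T -> Prop) : open [set t | P (h (f t))].
  by rewrite openE => t /= Pt; apply: filterS (loc t) => s /= ->.
have : `[0, 1]%classic `&` [set t | h (f t) = h (f 0)] = `[0, 1]%classic.
  apply: segment_connected.
  - by exists 0; split => //=; rewrite in_itv /= lexx ler01.
  - by exists [set t | h (f t) = h (f 0)] => //; exact: (op (fun z => z = h (f 0))).
  - exists [set t | h (f t) = h (f 0)] => //.
    by rewrite -openC; exact: (op (fun z => z <> h (f 0))).
move=> /seteqP [_ /(_ 1)] /=; rewrite in_itv /= ler01 lexx => /(_ isT) [_].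
have := hf 0; rewrite /y scale0r addr0 t1 inE => /eqP ->.
by have := hf 1; rewrite /y scale1r addrC subrK tb inE => /eqP ->.
Unshelve. all: by end_near.
Qed.

End chains.

(** * Independent functions on the set of cells *)

Section jumps.
Context {R : realType} {m N : nat}.
Implicit Types (a b : 'I_m -> 'I_N) (S : {set 'I_m}).
Implicit Types (Phi : {ffun 'I_m -> 'I_N} -> R).

Definition mix a b (J : {set 'I_m}) : {ffun 'I_m -> 'I_N} :=
  [ffun i => if i \in J then a i else b i].

(* The functional [\bigotimes_i (delta_(a i) - [i \in S] delta_(b i))] on
   functions of [m] variables. *)
Definition jump a b S Phi : R :=
  \sum_(J : {set 'I_m})
     (\prod_i (if i \in J then 1 else - (i \in S)%:R)) * Phi (mix a b J).

Lemma jump_prod a b S (psi : 'I_m -> 'I_N -> R) :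
  jump a b S (fun x => \prod_i psi i (x i)) =
  \prod_i (psi i (a i) - (i \in S)%:R * psi i (b i)).
Proof.
rewrite [RHS]bigA_distr; apply: eq_bigr => J _.
rewrite -big_split /=; apply: eq_bigr => i _; rewrite ffunE.
by case: ifP => _; rewrite ?mul1r ?mulNr.
Qed.

Lemma jump_ext a b S Phi Psi : Phi =1 Psi -> jump a b S Phi = jump a b S Psi.
Proof. by move=> e; apply: eq_bigr => J _; rewrite e. Qed.

Lemma jumpD a b S Phi Psi :
  jump a b S (fun x => Phi x + Psi x) = jump a b S Phi + jump a b S Psi.
Proof. by rewrite -big_split; apply: eq_bigr => J _; rewrite mulrDr. Qed.

Lemma jumpZ a b S k Phi : jump a b S (fun x => k * Phi x) = k * jump a b S Phi.
Proof. by rewrite mulr_sumr; apply: eq_bigr => J _; rewrite mulrCA. Qed.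

Lemma jump_sum a b S (I : finType) (Phi : I -> {ffun 'I_m -> 'I_N} -> R) :
  jump a b S (fun x => \sum_t Phi t x) = \sum_t jump a b S (Phi t).
Proof.
rewrite exchange_big; apply: eq_bigr => J _; exact: mulr_sumr.
Qed.

Definition label (j : 'I_N) : R := (j : nat)%:R.

Lemma label_inj : injective label.
Proof. by move=> i j /eqP; rewrite eqr_nat => /eqP/val_inj. Qed.

Definition monomial S (x : {ffun 'I_m -> 'I_N}) : R :=
  \prod_i (if i \in S then label (x i) else 1).

Definition jump_factor a b S : R :=
  \prod_i (if i \in S then label (a i) - label (b i) else 1).

Lemma jump_factor_neq0 a b S : (forall i, i \in S -> a i != b i) ->
  jump_factor a b S != 0.
Proof.
move=> ab; apply/prodf_neq0 => i _; case: ifP => [iS|_]; last exact: oner_neq0.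
by rewrite subr_eq0; apply: contra (ab i iS) => /eqP/label_inj ->.
Qed.

(** A direction of [S] outside [S'] contributes the factor 1 - 1. *)
Lemma jump_monomial0 a b S S' : ~~ (S \subset S') ->
  jump a b S (monomial S') = 0.
Proof.
move=> /subsetPn [i iS iS'].
rewrite (jump_prod a b S (fun i j => if i \in S' then label j else 1)).
by rewrite (bigD1 i) //= iS (negPf iS') mulr1 subrr mul0r.
Qed.

Lemma jump_monomial a b S : jump a b S (monomial S) = jump_factor a b S.
Proof.
rewrite (jump_prod a b S (fun i j => if i \in S then label j else 1)).
by apply: eq_bigr => i _; case: ifP => _; rewrite ?mul1r // mul0r subr0.
Qed.

(** No difference is taken in direction [j]: the functional evaluates there at [a j]. Boxes with
    different [a j] thus separate [S] from [j |: S]. *)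
Lemma jump_monomialU a b S j : j \notin S ->
  jump a b S (monomial (j |: S)%SET) = jump_factor a b S * label (a j).
Proof.
move=> jS; rewrite (jump_prod a b S (fun i k => if i \in (j |: S)%SET then label k else 1)).
rewrite /jump_factor (bigD1 j) //= [X in _ = X * _](bigD1 j) //= !inE eqxx (negPf jS) /=.
rewrite mul0r subr0 mul1r mulrC; congr (_ * _); apply: eq_bigr => i /negPf ij.
by rewrite !inE ij /=; case: ifP => _; rewrite ?mul1r // mul0r subr0.
Qed.

Lemma jump_coord a b S (h : 'I_N -> R) i : i \in S ->
  jump a b S (fun x => h (x i)) =
  if S == [set i]%SET then h (a i) - h (b i) else 0.
Proof.
move=> iS.
rewrite (jump_ext a b S
  (Psi := fun x => \prod_j (if j == i then h (x j) else 1))); last first.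
  by move=> x; rewrite -big_mkcond big_pred1_eq.
rewrite (jump_prod a b S (fun j k => if j == i then h k else 1)).
case: ifPn => [/eqP -> | Si].
  rewrite (bigD1 i) //= big1 ?mulr1 => [|j /negPf ji].
    by rewrite eqxx inE eqxx mul1r.
  by rewrite ji inE ji mul0r subr0.
have [j jS ji] : exists2 j, j \in S & j != i.
  apply: contrapT => no; case/eqP: Si; apply/setP => j; rewrite inE.
  apply/idP/eqP => [jS|->//]; apply: contrapT => /eqP ji; apply: no; by exists j.
by rewrite (bigD1 j) //= (negPf ji) jS mulr1 subrr mul0r.
Qed.

Lemma jump_coord0 a b S (h : 'I_N -> R) i j : j \in S -> j != i ->
  jump a b S (fun x => h (x i)) = 0.
Proof.
move=> jS ji.
rewrite (jump_ext a b S
  (Psi := fun x => \prod_j (if j == i then h (x j) else 1))); last first.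
  by move=> x; rewrite -big_mkcond big_pred1_eq.
rewrite (jump_prod a b S (fun j k => if j == i then h k else 1)).
by rewrite (bigD1 j) //= (negPf ji) jS mulr1 subrr mul0r.
Qed.

Lemma jump_coord2 a b S (h k : 'I_N -> R) i j : i != j ->
  jump a b S (fun x => h (x i) * k (x j)) =
  if S \subset [set i; j]%SET then
    (h (a i) - (i \in S)%:R * h (b i)) * (k (a j) - (j \in S)%:R * k (b j))
  else 0.
Proof.
move=> ij; have ji : j != i by rewrite eq_sym.
pose psi l z := if l == i then h z else if l == j then k z else 1.
rewrite (jump_ext a b S (Psi := fun x => \prod_l psi l (x l))); last first.
  move=> x; rewrite (bigD1 i) //= /psi eqxx; congr (_ * _).
  rewrite (bigD1 j ji) /= (negPf ji) eqxx big1 ?mulr1 // => l.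
  by move=> /andP [/negPf -> /negPf ->].
rewrite jump_prod; case: ifPn => [Sij | /subsetPn [l lS]].
  rewrite (bigD1 i) //= /psi eqxx; congr (_ * _).
  rewrite (bigD1 j ji) /= (negPf ji) eqxx big1 ?mulr1 // => l.
  move=> /andP [/negPf li /negPf lj]; rewrite li lj.
  have -> : l \in S = false.
    by apply/negbTE/negP => /(fintype.subsetP Sij); rewrite !inE li lj.
  by rewrite mul0r subr0.
rewrite !inE negb_or => /andP [/negPf li /negPf lj].
by rewrite (bigD1 l) //= /psi li lj lS mulr1 subrr mul0r.
Qed.

End jumps.

(** Independence on [X] means that the evaluation matrix has free rows, and its rank is at most its
    number of columns. *)
Lemma card_le_of_indep (R : fieldType) (T Y : finType) (I : {set T})
    (X : {set Y}) (phi : T -> Y -> R) :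
  (forall k : T -> R, (forall t, t \notin I -> k t = 0) ->
     (forall x, x \in X -> \sum_t k t * phi t x = 0) ->
     forall t, t \in I -> k t = 0) ->
  (#|I| <= #|X|)%N.
Proof.
move=> indep.
pose M : 'M[R]_(#|I|, #|X|) := \matrix_(i, j) phi (enum_val i) (enum_val j).
suff /eqP <- : row_free M by exact: rank_leq_col.
apply: inj_row_free => v vM; apply/rowP => i; rewrite mxE.
pose k t := if [pick j : 'I_#|I| | enum_val j == t] is Some j then v ord0 j else 0.
have kE j : k (enum_val j) = v ord0 j.
  rewrite /k; case: pickP => [j' /eqP/enum_val_inj -> //|/(_ j)].
  by rewrite eqxx.
rewrite -kE; apply: indep; last exact: enum_valP.
  move=> t tI; rewrite /k; case: pickP => // j /eqP e.
  by rewrite -e enum_valP in tI.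
move=> x xX; have := congr1 (fun A : 'rV[R]_#|X| => A ord0 (enum_rank_in xX x)) vM.
rewrite !mxE => h.
rewrite -[RHS]h (bigID (mem I)) /= [X in _ + X]big1 ?addr0; last first.
  move=> t tI; rewrite /k; case: pickP => [j /eqP e|]; last by rewrite mul0r.
  by rewrite -e enum_valP in tI.
rewrite big_enum_val /=; apply: eq_bigr => j _.
by rewrite kE mxE enum_rankK_in.
Qed.

(** * Linear independence on the set of cells *)

Section cell_functions.
Context {R : realType} {d N m : nat}.
Variables (p : 'I_N -> 'rV[R]_d) (c : 'I_N -> 'I_m) (gen : generic p).
Implicit Types (S : {set 'I_m}) (y : 'rV[R]_d).

Local Notation cls i := [set j | c j == i]%SET.

(** These tuples index the vertices of the Minkowski sum. *)
Definition cells : {set {ffun 'I_m -> 'I_N}} :=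
  [set x : {ffun 'I_m -> 'I_N} |
    `[< exists y, forall i, top p (cls i) y = [set x i]%SET >] ]%SET.

(** The vertices of all the summands together, each taken in its own class. *)
Definition exposed : {set 'I_N} :=
  [set a | `[< exists y, top p (cls (c a)) y = [set a]%SET >] ]%SET.

Hypothesis c_gt1 : forall i, (1 < #|cls i|)%N.

Lemma top_color i y a : a \in top p (cls i) y -> c a = i.
Proof. by move=> /(fintype.subsetP (top_sub _ _ _)); rewrite inE => /eqP. Qed.

Lemma cells_topP (x : {ffun 'I_m -> 'I_N}) y : y != 0 ->
  (forall i, x i \in top p (cls i) y) -> x \in cells.
Proof. by move=> y0 xt; rewrite inE; apply/asboolP; exact: (cells_at gen y0 xt). Qed.

Lemma cellsP (x : {ffun 'I_m -> 'I_N}) :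
  reflect (exists y, forall i, top p (cls i) y = [set x i]%SET) (x \in cells).
Proof. by rewrite inE; exact: asboolP. Qed.

Lemma top_set1_neq0 i y a : top p (cls i) y = [set a]%SET -> y != 0.
Proof.
move=> ty; apply/eqP => y0; have := c_gt1 i; rewrite ltnNge -(cards1 a) -ty.
apply/negP; rewrite negbK; apply: subset_leq_card.
by apply/fintype.subsetP => z zF; apply/topP; split=> // w _; rewrite y0 !dot0v.
Qed.

Lemma top_choice y (S : {set 'I_m}) :
  (forall i, i \in S -> (1 < #|top p (cls i) y|)%N) ->
  exists a b : 'I_m -> 'I_N, [/\ forall i, a i \in top p (cls i) y,
    forall i, b i \in top p (cls i) y & forall i, i \in S -> a i != b i].
Proof.
move=> yS; have /choice [ab hab] : forall i, exists z : 'I_N * 'I_N,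
    [/\ z.1 \in top p (cls i) y, z.2 \in top p (cls i) y & (i \in S -> z.1 != z.2)].
  move=> i; have [iS|iS] := boolP (i \in S).
    by have /card_gt1P [v [w [vt wt vw]]] := yS i iS; exists (v, w).
  have /card_gt0P [v vc] := ltnW (c_gt1 i).
  by have [w wt] := top_witness p y vc; exists (w, w).
by exists (fun i => (ab i).1), (fun i => (ab i).2); split=> i; case: (hab i).
Qed.

Lemma top_point y : exists x : 'I_m -> 'I_N, forall i, x i \in top p (cls i) y.
Proof.
have [i|x [_ [xt _ _]]] := @top_choice y finset.set0; first by rewrite inE.
by exists x.
Qed.

Lemma exposed_top i y a : y != 0 -> a \in top p (cls i) y -> a \in exposed.
Proof.
move=> y0 at_; have [x xt] := top_point y.
have [|z hz] := @cells_at _ _ _ _ p c gen (fun j => if j == i then a else x j) y y0.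
  by move=> j; case: eqP => [->|].
by rewrite inE; apply/asboolP; exists z; rewrite (top_color at_) hz eqxx.
Qed.

Lemma cells_exposed x i : x \in cells -> x i \in exposed.
Proof.
move=> /cellsP [y hy]; apply: (@exposed_top i y); last by rewrite hy set11.
exact: top_set1_neq0 (hy i).
Qed.

(** All corners of a box chosen from the faces at a nonzero [y] are cells. *)
Lemma jump_cells (Phi : {ffun 'I_m -> 'I_N} -> R) y (a b : 'I_m -> 'I_N) S :
  (forall x, x \in cells -> Phi x = 0) -> y != 0 ->
  (forall i, a i \in top p (cls i) y) -> (forall i, b i \in top p (cls i) y) ->
  jump a b S Phi = 0.
Proof.
move=> Phi0 y0 at_ bt; apply: big1 => J _; rewrite Phi0 ?mulr0 //.
by apply: (cells_topP y0) => i; rewrite ffunE; case: ifP.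
Qed.

Variable m0 : 'I_m.

(** A general element of the span. A single [h] encodes one function per coordinate because the
    classes are disjoint; [q] weighs the additional function of the strict inequality. *)
Definition cell_poly (e : {set 'I_m} -> R) (h : 'I_N -> R) (q : R) i1 a1
    (x : {ffun 'I_m -> 'I_N}) : R :=
  \sum_S e S * monomial S x + \sum_i h (x i) +
  q * ((x i1 == a1)%:R * label (x m0)).

Lemma jump_cell_poly e h q i1 a1 (a b : 'I_m -> 'I_N) S :
  jump a b S (cell_poly e h q i1 a1) =
  \sum_T e T * jump a b S (monomial T) + \sum_i jump a b S (fun x => h (x i)) +
  q * jump a b S (fun x => (x i1 == a1)%:R * label (x m0)).
Proof.
rewrite /cell_poly !jumpD jumpZ !jump_sum; congr (_ + _ + _).
by apply: eq_bigr => T _; rewrite jumpZ.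
Qed.

Lemma jump_coords0 (h : 'I_N -> R) (a b : 'I_m -> 'I_N) S : (1 < #|S|)%N ->
  \sum_i jump a b S (fun x => h (x i)) = 0.
Proof.
move=> /card_gt1P [j [k [jS kS jk]]]; apply: big1 => i _.
have [ji|ji] := eqVneq j i; last exact: jump_coord0 jS ji.
by apply: (jump_coord0 _ _ _ kS); rewrite -ji eq_sym.
Qed.

(* Two boxes in the directions [i1], [m0] that tell apart [1_(x i1 = a1) g(x m0)]
   and [g(x i1) g(x m0)]: only the first one uses the vertex [a1]. *)
Definition box_separated i1 a1 : Prop :=
  [/\ i1 != m0,
      exists y, [/\ y != 0, (1 < #|top p (cls m0) y|)%N, (1 < #|top p (cls i1) y|)%N
                  & a1 \in top p (cls i1) y]
    & exists y, [/\ y != 0, (1 < #|top p (cls m0) y|)%N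
                  & (1 < #|top p (cls i1) y :\ a1|)%N]].

(** Coefficients are eliminated in order: sets of size [d], the other sets with two or more elements
    by decreasing size, [q], [h], and the constant. Since constants occur as the empty monomial, [h]
    is normalized at one point of each class. *)
Lemma cell_poly_indep e h q i1 a1 (a0 : 'I_m -> 'I_N) : (2 < d)%N ->
  (forall S, e S != 0 -> (#|S :\ m0| < d)%N && (#|S| != 1)%N) ->
  (forall i, [/\ a0 i \in exposed, c (a0 i) = i & h (a0 i) = 0]) ->
  (q != 0 -> box_separated i1 a1) ->
  (forall x, x \in cells -> cell_poly e h q i1 a1 x = 0) ->
  [/\ forall S, e S = 0, forall a, a \in exposed -> h a = 0 & q = 0].
Proof.
move=> d2 esupp a0P qsep fam0; have d_gt1 : (1 < d)%N := ltnW d2.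
have jump0 S y a b : y != 0 -> (forall i, a i \in top p (cls i) y) ->
    (forall i, b i \in top p (cls i) y) -> (1 < #|S|)%N ->
    \sum_T e T * jump a b S (monomial T) +
    q * jump a b S (fun x => (x i1 == a1)%:R * label (x m0)) = 0.
  move=> y0 at_ bt S1; have := jump_cells S fam0 y0 at_ bt.
  by rewrite jump_cell_poly jump_coords0 // addr0.
(* Such an [S] has [d] elements, too many for [ties_exist]. Boxes in the directions of [S1] relate
   [e S1] and [e S] through the label at [m0]; two different labels force [e S = 0]. *)
have etop S : m0 \in S -> #|S :\ m0| = d.-1 -> e S = 0.
  set S1 := (S :\ m0)%SET => mS cS; have mS1 : m0 \notin S1 by rewrite !inE eqxx.
  have S1E : S = (m0 |: S1)%SET by rewrite /S1 finset.setD1K.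
  have S1gt1 : (1 < #|S1|)%N by rewrite cS -ltnS prednK // (ltn_trans _ d_gt1).
  have S1d : (#|S1| < d)%N by rewrite cS prednK // (ltn_trans _ d_gt1).
  have eqS y a b : y != 0 -> (forall i, a i \in top p (cls i) y) ->
      (forall i, b i \in top p (cls i) y) -> (forall i, i \in S1 -> a i != b i) ->
      e S1 + e S * label (a m0) = 0.
    move=> y0 at_ bt ab; have := jump0 S1 y a b y0 at_ bt S1gt1.
    (* The function depends on the coordinates [i1] and [m0] only, and [S1] contains some other
       index. *)
    have -> : q * jump a b S1 (fun x => (x i1 == a1)%:R * label (x m0)) = 0.
      have [->|/qsep [im _ _]] := eqVneq q 0; first by rewrite mul0r.
      rewrite (@jump_coord2 _ _ _ a b S1 (fun z => (z == a1)%:R) label) //.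
      case: ifPn => [sub|_]; rewrite ?mulr0 //.
      have : S1 \subset [set i1]%SET.
        apply/fintype.subsetP => i iS1; have := fintype.subsetP sub i iS1.
        by rewrite !inE => /orP [//|/eqP im0]; rewrite im0 (negPf mS1) in iS1.
      by move=> /subset_leq_card; rewrite cards1 leqNgt S1gt1.
    have S1S : S != S1 by apply: contraNneq mS1 => <-.
    (* In the support of [e] only [S1] and [S] contain [S1], because [T :\ m0] has fewer than [d]
       elements. *)
    rewrite addr0 (bigD1 S1) //= (bigD1 S) //= big1 ?addr0; last first.
      move=> T /andP [TS1 TS]; have [->|/esupp /andP [Td _]] := eqVneq (e T) 0.
        by rewrite mul0r.
      rewrite jump_monomial0 ?mulr0 //; apply: contra TS => sub.
      have sub' : S1 \subset (T :\ m0)%SET by rewrite subsetD1 sub mS1.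
      have /eqP S1T : S1 == (T :\ m0)%SET.
        by rewrite eqEcard sub' cS -ltnS prednK // (ltn_trans _ d_gt1).
      have [mT|mT] := boolP (m0 \in T).
        by rewrite S1E S1T finset.setD1K.
      move: TS1; rewrite S1T; case/eqP; apply/setP => i; rewrite !inE.
      by case: eqP => // ->; rewrite (negPf mT).
    have -> : jump a b S1 (monomial S) = jump_factor a b S1 * label (a m0) :> R.
      by rewrite S1E jump_monomialU.
    rewrite jump_monomial [e S1 * _]mulrC mulrCA -mulrDr.
    by move/eqP; rewrite mulf_eq0 (negPf (jump_factor_neq0 ab)) /= => /eqP.
  have [y y0 yS] := ties_exist gen c_gt1 S1d.
  have [a [b [at_ bt ab]]] := top_choice yS.
  have ac : a m0 \in cls m0 by rewrite inE (top_color (at_ m0)).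
  have [y' [y'0 y'S [w wt wa]]] := ties_avoid gen mS1 ac c_gt1 S1d.
  have [a' [b' [a't b't a'b']]] := top_choice y'S.
  have e1 := eqS y a b y0 at_ bt ab.
  have e2 : e S1 + e S * label w = 0.
    have := eqS y' (fun i => if i == m0 then w else a' i) b' y'0; rewrite eqxx; apply=> // i.
      by case: eqP => [->|_].
    by move=> iS; rewrite ifN ?a'b' //; apply: contraNneq mS1 => <-.
  have /eqP : e S * (label w - label (a m0)) = 0.
    rewrite mulrBr -(addrK (e S1) (e S * label w)) [_ + e S1]addrC e2.
    by rewrite sub0r -opprD e1 oppr0.
  rewrite mulf_eq0 subr_eq0 => /orP [/eqP -> // | /eqP/label_inj wam].
  by rewrite wam eqxx in wa.
(* Descending induction on the size: a box in the directions of [S] kills monomials of sets not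
   containing [S], and strictly larger sets already have coefficient 0. *)
have e0 S : (1 < #|S|)%N -> e S = 0.
  have [n] := ubnP (m - #|S|)%N; elim: n S => // n IHn S Sn S1.
  have [//|/eqP eS] := eqVneq (e S) 0; have /andP [Sd _] := esupp S (introN eqP eS).
  have sup (T : {set _}) : S \proper T -> e T = 0.
    move=> ST; apply: IHn; last by apply: ltn_trans S1 (proper_card ST).
    have Tm : (#|T| <= m)%N by rewrite -[X in (_ <= X)%N]card_ord max_card.
    have := proper_card ST; move: Sn Tm; move: #|T| #|S| => kT kS; lia.
  have [/andP [mS /eqP cS]|top_] := boolP ((m0 \in S) && (#|S :\ m0| == d.-1)).
    exact: etop.
  have {}Sd : (#|S| < d)%N.
    move: top_ Sd; rewrite (cardsD1 m0 S); case: (m0 \in S) => /=; last by rewrite add0n.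
    by move: (#|_|) => k; lia.
  (* The box must also kill the additional function. This is automatic unless [S] is the pair of
     [i1] and [m0]; then the box of [box_separated] that avoids [a1] is used. *)
  have [y [a [b [y0 at_ bt ab extra]]]] : exists y, exists a b : 'I_m -> 'I_N,
      [/\ y != 0, forall i, a i \in top p (cls i) y,
        forall i, b i \in top p (cls i) y, forall i, i \in S -> a i != b i &
        q * jump a b S (fun x => (x i1 == a1)%:R * label (x m0)) = 0].
    have [q0|qn0] := eqVneq q 0.
      have [y y0 yS] := ties_exist gen c_gt1 Sd.
      have [a [b [at_ bt ab]]] := top_choice yS.
      by exists y, a, b; split=> //; rewrite q0 mul0r.
    have [im _ [y [y0 ym yi]]] := qsep qn0.
    have [SE|SE] := boolP (S \subset [set i1; m0]%SET); last first.
      have [z z0 zS] := ties_exist gen c_gt1 Sd.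
      have [a [b [at_ bt ab]]] := top_choice zS.
      exists z, a, b; split=> //.
      rewrite (@jump_coord2 _ _ _ a b S (fun z => (z == a1)%:R) label) //.
      by rewrite (negPf SE) mulr0.
    have {SE} /eqP SE : S == [set i1; m0]%SET.
      by rewrite eqEcard SE cards2 im.
    have yS i : i \in S -> (1 < #|top p (cls i) y|)%N.
      rewrite SE in_set2 => /orP [] /eqP -> //.
      by apply: leq_trans yi (subset_leq_card (subD1set _ _)).
    have [a [b [at_ bt ab]]] := top_choice yS.
    have /card_gt1P [v [w [vt wt vw]]] := yi.
    move: vt wt; rewrite !in_setD1 => /andP [va vt] /andP [wa wt].
    exists y, (fun i => if i == i1 then v else a i), (fun i => if i == i1 then w else b i).
    split=> // [i|i|i iS|]; try by case: eqP => [->|_] //.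
      by have [_|_] := eqVneq i i1; [exact: vw | exact: ab].
    rewrite (@jump_coord2 _ _ _ _ _ S (fun z => (z == a1)%:R) label) //.
    by rewrite eqxx (negPf va) (negPf wa) mulr0 subr0 mul0r if_same mulr0.
  have := jump0 S y a b y0 at_ bt S1; rewrite extra addr0 (bigD1 S) //= big1 ?addr0.
    rewrite jump_monomial => /eqP.
    by rewrite mulf_eq0 (negPf (jump_factor_neq0 ab)) orbF => /eqP.
  move=> T TS; have [sub|sub] := boolP (S \subset T); last by rewrite jump_monomial0 ?mulr0.
  by rewrite sup ?mul0r // finset.properEneq sub andbT eq_sym.
(* In the box through [a1] only the side [x i1 = a1] counts, which leaves [q] times a difference of
   two labels at [m0]. *)
have q0 : q = 0.
  have [//|qn0] := eqVneq q 0; have [im [y [y0 ym yi at1]] _] := qsep qn0.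
  pose S := [set i1; m0]%SET.
  have yS i : i \in S -> (1 < #|top p (cls i) y|)%N.
    by rewrite in_set2 => /orP [] /eqP ->.
  have [a [b [at_ bt ab]]] := top_choice yS.
  have [b1 b1t b1a] : exists2 b1, b1 \in top p (cls i1) y & b1 != a1.
    have /card_gt1P [v [w [vt wt vw]]] := yi.
    by have [e'|] := eqVneq v a1; [exists w; rewrite // -e' eq_sym | exists v].
  have S1 : (1 < #|S|)%N by rewrite cards2 im.
  have := jump0 S y (fun i => if i == i1 then a1 else a i)
    (fun i => if i == i1 then b1 else b i) y0 _ _ S1.
  rewrite big1 ?add0r => [|T _]; last first.
    have [sub|sub] := boolP (S \subset T); last by rewrite jump_monomial0 ?mulr0.
    by rewrite e0 ?mul0r //; apply: leq_trans S1 (subset_leq_card sub).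
  rewrite (@jump_coord2 _ _ _ _ _ S (fun z => (z == a1)%:R) label) //.
  rewrite fintype.subxx !in_set2 !eqxx orbT /= (negPf b1a) !mul1r subr0 mul1r.
  rewrite eq_sym (negPf im) => hh.
  have /eqP : q * (label (a m0) - label (b m0)) = 0.
    by apply: hh => i; case: eqP => [->|].
  rewrite mulf_eq0 (negPf qn0) subr_eq0 /= => /eqP/label_inj/eqP.
  by rewrite (negPf (ab m0 _)) // in_set2 eqxx orbT.
have e1 S : S != finset.set0 -> e S = 0.
  move=> S0; have [//|/esupp /andP [_ S1]] := eqVneq (e S) 0.
  by apply: e0; rewrite ltn_neqAle eq_sym S1 card_gt0.
(* A box in the single direction [i] compares [h] at two tied points; [chain_const] then spreads the
   equality over the class. *)
have heq i y : y != 0 -> {in top p (cls i) y &, forall a b, h a = h b}.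
  move=> y0 a b at_ bt.
  have [x xt] := top_point y.
  have := @jump_cells _ y (fun j => if j == i then a else x j)
    (fun j => if j == i then b else x j) [set i]%SET fam0 y0 _ _.
  rewrite jump_cell_poly q0 mul0r addr0 big1 ?add0r; last first.
    move=> T _; have [-> |T0] := eqVneq T finset.set0; last by rewrite e1 ?mul0r.
    rewrite jump_monomial0 ?mulr0 // finset.subset0.
    by apply/finset.set0Pn; exists i; rewrite set11.
  rewrite (bigD1 i) //= big1 ?addr0; last first.
    by move=> j ji; apply: jump_coord0 (set11 i) _; rewrite eq_sym.
  rewrite jump_coord ?set11 // !eqxx => hh; apply/eqP; rewrite -subr_eq0; apply/eqP.
  by apply: hh => j; case: eqP => [->|].
have h0 a : a \in exposed -> h a = 0.
  rewrite inE => /asboolP [ya hya]; have [] := a0P (c a).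
  rewrite inE => /asboolP [yb]; set b := a0 (c a) => hyb cb <-.
  rewrite cb in hyb.
  by apply: chain_const hya hyb => //; exact: heq.
(* Only the constant is left, and one cell evaluates it. *)
split=> // S; have [->|] := eqVneq S finset.set0; last exact: e1.
have [|y y0 _] := @ties_exist _ _ _ _ p c gen finset.set0 c_gt1; first by rewrite cards0 ltnW.
have [x xt] := top_point y.
have xC : [ffun i => x i] \in cells by apply: (cells_topP y0) => i; rewrite ffunE.
have := fam0 _ xC; rewrite /cell_poly q0 mul0r addr0 [X in _ + X]big1 ?addr0; last first.
  by move=> i _; apply: h0; exact: cells_exposed.
rewrite (bigD1 finset.set0) //= big1 ?addr0 => [|T T0]; last by rewrite e1 ?mul0r.
by rewrite /monomial big1 ?mulr1 // => i _; rewrite inE.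
Qed.

End cell_functions.

(** * Counting the exponent sets *)

Lemma card_small_subsets (T : finType) (B : {set T}) d :
  #|[set A : {set T} | (A \subset B) && (#|A| < d)%N]%SET| =
  (\sum_(k < d) 'C(#|B|, k))%N.
Proof.
elim: d => [|d IHd]; first by rewrite big_ord0; apply/eqP; rewrite cards_eq0;
  apply/eqP/setP => A; rewrite !inE ltn0 andbF.
rewrite big_ord_recr /= -IHd -cards_draws.
rewrite -[LHS](cardsID [set A : {set T} | (#|A| < d)%N]%SET); congr (_ + _)%N.
  by apply: eq_card => A; rewrite !inE -andbA; congr (_ && _); lia.
by apply: eq_card => A; rewrite !inE andbCA; congr (_ && _); lia.
Qed.

(** Removing [m0] is two-to-one onto the small subsets of the complement of [m0]. *)
Lemma card_sets_mod_point m d (m0 : 'I_m) :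
  #|[set S : {set 'I_m} | (#|S :\ m0| < d)%N]%SET| =
  (2 * \sum_(k < d) 'C(m - 1, k))%N.
Proof.
have Bm : #|~: [set m0]%SET| = (m - 1)%N.
  by rewrite cardsC1 card_ord subn1.
rewrite -Bm -card_small_subsets.
set Q := [set A : {set 'I_m} | (A \subset ~: [set m0]) && (#|A| < d)%N]%SET.
have subC (A : {set 'I_m}) : m0 \notin A -> A \subset (~: [set m0])%SET.
  by move=> mA; apply/fintype.subsetP => i iA; rewrite !inE; apply: contraNneq mA => <-.
have QP A : A \in Q -> m0 \notin A.
  rewrite inE => /andP [sub _]; apply/negP => /(fintype.subsetP sub).
  by rewrite !inE eqxx.
rewrite -(cardsID [set S : {set 'I_m} | m0 \in S]%SET) mul2n -addnn.
congr (_ + _)%N; last first.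
  apply: eq_card => S; rewrite !inE; have [mS|mS] /= := boolP (m0 \in S).
    by apply/esym/negbTE/negP => h; have := QP S; rewrite inE => /(_ h); rewrite mS.
  rewrite (_ : S :\ m0 = S)%SET; last first.
    by apply/setP => i; rewrite !inE; case: eqP => // ->; rewrite (negPf mS).
  by rewrite subC.
rewrite -(card_in_imset (f := fun S => (m0 |: S)%SET) (D := mem Q)); last first.
  by move=> S S' /QP SQ /QP S'Q e; rewrite -(finset.setU1K SQ) e finset.setU1K.
apply: eq_card => S; rewrite !inE; apply/andP/imsetP => [[Sd mS]|[S' S'Q ->]].
  exists (S :\ m0)%SET; last by rewrite finset.setD1K.
  by rewrite inE Sd andbT subC // !inE eqxx.
rewrite finset.setU1K ?QP // !inE eqxx; split=> //.
by move: S'Q; rewrite inE => /andP [].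
Qed.

(** * The lower bound from dimension three on *)

Section lower_bound.
Context {R : realType} {d N m : nat}.
Variables (p : 'I_N -> 'rV[R]_d) (c : 'I_N -> 'I_m) (gen : generic p).

Local Notation cls i := [set j | c j == i]%SET.
Local Notation cells := (cells p c).
Local Notation exposed := (exposed p c).

Hypothesis c_gt1 : forall i, (1 < #|cls i|)%N.

(** The independent family of [cell_poly_indep] is counted. The boolean [strict], read as a number,
    adds the additional function when separating boxes are available. *)
Lemma lower_bound_ge3 (m0 : 'I_m) i1 a1 (strict : bool) : (2 < d)%N ->
  (strict -> box_separated p c m0 i1 a1) ->
  (#|exposed| + 2 * \sum_(k < d) 'C(m - 1, k) + strict <= #|cells| + 2 * m)%N.
Proof.
move=> d2 sep; have d1 : (1 < d)%N by exact: ltnW.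
have /choice [a0 a0P] : forall i, exists a, a \in exposed /\ c a = i.
  move=> i; have [|y y0 _] := ties_exist gen c_gt1 (S := finset.set0).
    by rewrite cards0 ltnW.
  have /card_gt0P [v vc] := ltnW (c_gt1 i).
  have [a at_] := top_witness p y vc.
  by exists a; split; [exact: exposed_top y0 at_ | exact: top_color at_].
have a0inj : injective a0.
  by move=> i j e; case: (a0P i) => _ <-; case: (a0P j) => _ <-; rewrite e.
(* One exposed point per class is left out: the indicators of a class sum to 1 on cells, which is
   the empty monomial. *)
pose V := (exposed :\: [set a0 i | i in 'I_m])%SET.
have cV : (#|V| + m = #|exposed|)%N.
  suff cI : #|(exposed :&: [set a0 i | i in 'I_m])%SET| = m.
    by rewrite -(cardsID [set a0 i | i in 'I_m]%SET exposed) cI addnC.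
  rewrite -[RHS](card_ord m) -(card_imset _ a0inj); apply: eq_card => a.
  rewrite !inE; apply/andP/idP => [[_ ->]//|aI]; split=> //.
  by case/imsetP: aI => i _ ->; case: (a0P i); rewrite inE.
(* Monomials of singletons are functions of one coordinate, hence left out. The two omissions
   account for [2 * m]. *)
pose Q := [set S : {set 'I_m} | (#|S :\ m0| < d)%N && (#|S| != 1)%N]%SET.
have cQ : (#|Q| + m = 2 * \sum_(k < d) 'C(m - 1, k))%N.
  rewrite -(card_sets_mod_point d m0).
  pose X := [set S : {set 'I_m} | (#|S :\ m0| < d)%N]%SET; rewrite -/X.
  suff cX : #|(X :&: [set S : {set 'I_m} | #|S| == 1]%SET)%SET| = m.
    rewrite -(cardsID [set S : {set 'I_m} | #|S| == 1]%SET X) cX addnC.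
    by congr (m + _)%N; apply: eq_card => S; rewrite !inE andbC.
  rewrite -[RHS](card_ord m) -(card_imset 'I_m (@finset.set1_inj 'I_m)).
  apply: eq_card => S; rewrite !inE; apply/andP/imsetP => [[_ /cards1P [i ->]]|[i _ ->]].
    by exists i.
  rewrite cards1; split=> //; apply: leq_ltn_trans d1.
  by rewrite -(cards1 i) subset_leq_card // subD1set.
pose I := [set t : ({set 'I_m} + 'I_N) + unit | match t with
  | inl (inl A) => A \in Q | inl (inr a) => a \in V | inr _ => strict end]%SET.
have cI : #|I| = (#|Q| + #|V| + strict)%N.
  rewrite -sum1_card big_sumType big_sumType /=; congr (_ + _ + _)%N.
  - by rewrite -sum1_card; apply: eq_bigl => S; rewrite inE.
  - by rewrite -sum1_card; apply: eq_bigl => a; rewrite inE.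
  - rewrite (eq_bigl (fun=> strict)); last by move=> u; rewrite inE.
    by case: (strict); [rewrite (big_pred1 tt) //; case | rewrite big_pred0].
suff : (#|I| <= #|cells|)%N by rewrite cI -cV -cQ; lia.
pose phi (t : ({set 'I_m} + 'I_N) + unit) (x : {ffun 'I_m -> 'I_N}) : R :=
  match t with
  | inl (inl A) => monomial A x
  | inl (inr a) => (x (c a) == a)%:R
  | inr _ => (x i1 == a1)%:R * label (x m0)
  end.
apply: (card_le_of_indep (phi := phi)) => k ksupp k0.
pose e S := k (inl (inl S)); pose h a := k (inl (inr a)); pose q := k (inr tt).
have fam0 x : x \in cells -> cell_poly m0 e h q i1 a1 x = 0.
  move=> xC; rewrite -[RHS](k0 x xC) big_sumType big_sumType /=; congr (_ + _ + _).
    rewrite (partition_big c xpredT) //=; apply: eq_bigr => i _.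
    have ci : c (x i) = i.
      case/cellsP: xC => y /(_ i) hy; apply: (@top_color _ _ _ _ p c i y).
      by rewrite hy set11.
    rewrite (bigD1 (x i)) /= ?ci ?eqxx // mulr1 big1 ?addr0 // => a /andP [/eqP -> ax].
    by rewrite eq_sym (negPf ax) mulr0.
  by rewrite (big_pred1 tt) //; case.
have [|||e0 h0 q0] := cell_poly_indep gen c_gt1 (a0 := a0) d2 _ _ _ fam0.
- move=> S; apply: contraNT => SQ; apply/eqP; apply: ksupp.
  by rewrite !inE.
- move=> i; have [a0E ca] := a0P i; split=> //; apply: ksupp.
  by rewrite !inE imset_f.
- move=> q0; apply: sep; move: q0; apply: contraNT => ns; apply/eqP; apply: ksupp.
  by rewrite inE.
move=> [[S|a]|[]] tI; [exact: e0 | | exact: q0].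
by apply: h0; move: tI; rewrite inE => /finset.setDP [].
Qed.

End lower_bound.

(** * Dimensions one and two *)

Section low_dimension.
Context {R : realType} {N m : nat}.
Variables (c : 'I_N -> 'I_m).

Local Notation cls i := [set j | c j == i]%SET.

Hypothesis c_gt1 : forall i, (1 < #|cls i|)%N.

Section dimension_one.
Variables (p : 'I_N -> 'rV[R]_1) (gen : generic p).

Lemma dotv1E (u v : 'rV[R]_1) : dotv u v = u ord0 ord0 * v ord0 ord0.
Proof. by rewrite /dotv big_ord1. Qed.

(** Up to positive scaling a nonzero functional on the line is 1 or -1. Each selects one end of
    every summand, and the two ends differ. *)
Lemma dim1_cells_exposed : (0 < m)%N ->
  #|cells p c| = 2 /\ #|exposed p c| = (2 * m)%N.
Proof.
move=> m0; have one0 (s : R) : s != 0 -> (s%:M : 'rV[R]_1) != 0.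
  by move=> s0; apply/eqP => /rowP /(_ ord0); rewrite !mxE mulr1n; apply/eqP.
have top1 (s : R) i : s != 0 -> exists a, top p (cls i) s%:M = [set a]%SET.
  move=> s0; have /card_gt0P [v vc] := ltnW (c_gt1 i).
  have [a at_] := top_witness p s%:M vc; exists a.
  apply/setP => b; rewrite inE; apply/idP/eqP => [bt|->//].
  have := top_eq at_ bt; rewrite !dotv1E !mxE mulr1n => /(mulfI s0) e.
  apply: (generic_inj gen) => //; apply/rowP => k.
  by rewrite (ord1 k).
have /choice [u hu] : forall i, exists a, top p (cls i) 1%:M = [set a]%SET.
  by move=> i; apply: top1; exact: oner_neq0.
have /choice [l hl] : forall i, exists a, top p (cls i) (-1)%:M = [set a]%SET.
  by move=> i; apply: top1; rewrite oppr_eq0 oner_neq0.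
have cu i : c (u i) = i by apply: (@top_color _ _ _ _ p c i 1%:M); rewrite hu set11.
have cl i : c (l i) = i by apply: (@top_color _ _ _ _ p c i (-1)%:M); rewrite hl set11.
have ul i : u i != l i.
  apply/eqP => e; have /card_gt1P [a [b [ac bc ab]]] := c_gt1 i.
  have [_ hu'] := (top1P p _ _ _).1 (hu i); have [_ hl'] := (top1P p _ _ _).1 (hl i).
  have cases x : x \in cls i -> x = u i.
    move=> xc; apply/eqP; apply: contraT => xu; have := hu' x xc xu.
    rewrite -e in hl'; have := hl' x xc xu.
    by rewrite !dotv1E !mxE !mulr1n; lra.
  by rewrite (cases a ac) (cases b bc) eqxx in ab.
have topy i (y : 'rV[R]_1) : y != 0 ->
    top p (cls i) y = [set if 0 < y ord0 ord0 then u i else l i]%SET.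
  move=> y0; have y00 : y ord0 ord0 != 0.
    by apply: contraNneq y0 => e; apply/eqP/rowP => k; rewrite (ord1 k) e mxE.
  have yE (s : R) : y ord0 ord0 = s -> y = s%:M.
    by move=> e; apply/rowP => k; rewrite (ord1 k) e !mxE.
  case: ifPn => [ypos|]; last rewrite -leNgt le_eqVlt (negPf y00) /= => yneg.
    rewrite -hu (_ : y = y ord0 ord0 *: 1%:M) ?topZ //.
    by rewrite scale_scalar_mx mulr1; exact: yE.
  rewrite -hl (_ : y = (- y ord0 ord0) *: (-1)%:M) ?topZ ?oppr_gt0 //.
  by rewrite scale_scalar_mx mulrNN mulr1; exact: yE.
split.
  have -> : cells p c = [set [ffun i => u i]; [ffun i => l i]]%SET.
    apply/setP => x; rewrite in_set2; apply/cellsP/orP => [[y hy]|].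
      have y0 : y != 0 := top_set1_neq0 c_gt1 (hy (Ordinal m0)).
      have xE i : x i = if 0 < y ord0 ord0 then u i else l i.
        by have := hy i; rewrite topy // => /finset.set1_inj.
      case: (boolP (0 < y ord0 ord0)) => y1; [left | right]; apply/eqP/ffunP => i.
        by rewrite ffunE xE y1.
      by rewrite ffunE xE (negPf y1).
    move=> [] /eqP ->; [exists 1%:M | exists (-1)%:M] => i; rewrite ffunE //.
  suff ne : [ffun i => u i] != [ffun i => l i] by rewrite cards2 ne.
  by apply/eqP => /ffunP /(_ (Ordinal m0)); rewrite !ffunE; apply/eqP.
have -> : exposed p c = ([set u i | i in 'I_m] :|: [set l i | i in 'I_m])%SET.
  apply/setP => a; rewrite !inE; apply/asboolP/orP => [[y hy]|].
    have y0 : y != 0 := top_set1_neq0 c_gt1 hy.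
    move: hy; rewrite topy // => /finset.set1_inj <-.
    by case: ifP => _; [left|right]; exact: imset_f.
  by move=> [] /imsetP [i _ ->]; rewrite ?cu ?cl; [exists 1%:M | exists (-1)%:M].
have uinj : injective u by move=> i j e; rewrite -(cu i) e cu.
have linj : injective l by move=> i j e; rewrite -(cl i) e cl.
suff UL : ([set u i | i in 'I_m] :&: [set l i | i in 'I_m])%SET = finset.set0.
  by rewrite cardsU UL !card_imset // card_ord cards0 subn0 mul2n addnn.
apply/setP => a; rewrite !inE; apply/negP => /andP [/imsetP [i _ ->] /imsetP [j _ e]].
have ij : i = j by rewrite -(cu i) e cl.
by move: (ul i); rewrite e ij eqxx.
Qed.

End dimension_one.

(** * The plane *)

Section dimension_two.
Variables (p : 'I_N -> 'rV[R]_2) (gen : generic p).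
Implicit Types (u v w y z : 'rV[R]_2).

Let i1 : 'I_2 := lift ord0 ord0.

Definition rot y : 'rV[R]_2 :=
  \row_k if k == ord0 then - y ord0 i1 else y ord0 ord0.

Lemma dotv2E u v :
  dotv u v = u ord0 ord0 * v ord0 ord0 + u ord0 i1 * v ord0 i1.
Proof. by rewrite /dotv !big_ord_recl big_ord0 addr0. Qed.

Lemma dotv_rotl u v : dotv (rot u) v = - dotv u (rot v).
Proof. by rewrite !dotv2E !mxE /=; ring. Qed.

(** Expansion of the inner product in the orthogonal frame [v], [rot v]. *)
Lemma dotv_frame w u v :
  dotv w u * dotv v v = dotv w v * dotv u v + dotv w (rot v) * dotv u (rot v).
Proof. by rewrite !dotv2E !mxE /=; ring. Qed.

(* [z] is obtained by rotating [y] clockwise until another vertex ties with [a]. *)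
Lemma entry_ray a : a \in exposed p c ->
  exists z q, [/\ z != 0, a \in top p (cls (c a)) z, q \in top p (cls (c a)) z,
                  q != a & 0 < dotv (rot z) (p a - p q)].
Proof.
rewrite inE => /asboolP [y /top1P [ac ya]].
have pos q : q \in cls (c a) -> q != a -> 0 < dotv y (p a - p q).
  by move=> qc qa; rewrite dotvBr subr_gt0 ya.
have [q0 q0c q0a] : exists2 q, q \in cls (c a) & q != a.
  have /card_gt1P [v [w [vc wc vw]]] := c_gt1 (c a).
  by have [e|] := eqVneq v a; [exists w; rewrite // -e eq_sym | exists v].
(* The functional [s q *: y - rot y] ties [a] with [q]. The largest [s q] is met first when rotating
   away from [y], so [a] is still maximal there. *)
pose s q := dotv (rot y) (p a - p q) / dotv y (p a - p q).
have q0P : q0 \in (cls (c a) :\ a)%SET by rewrite in_setD1 q0c q0a.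
case: (arg_maxP s q0P) => q /finset.setD1P [qa qc] smax.
pose z := s q *: y - rot y.
have zE x : x \in cls (c a) -> x != a ->
    dotv z (p a - p x) = dotv y (p a - p x) * (s q - s x).
  move=> xc xa; rewrite /z dotvDl dotvNl dotvZl mulrBr /s.
  rewrite (mulrC (dotv y (p a - p x)) (_ / dotv y (p a - p x))) divfK ?gt_eqF ?pos //.
  by rewrite mulrC.
have rz : rot z = s q *: rot y + y.
  apply/rowP => k; rewrite !mxE /=; case: (eqVneq k ord0) => [->|k0] /=; first by ring.
  have -> : k = i1 by apply: val_inj; case: k k0 => [[|[|]]].
  by ring.
have rzq : 0 < dotv (rot z) (p a - p q).
  rewrite rz dotvDl dotvZl.
  have -> : dotv (rot y) (p a - p q) = s q * dotv y (p a - p q).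
    by rewrite /s divfK // gt_eqF // pos.
  rewrite mulrA -[X in _ + X]mul1r -mulrDl mulr_gt0 ?pos //.
  by rewrite -expr2 ltr_wpDl // sqr_ge0.
have z0 : z != 0.
  by apply: contraTneq rzq => ->; rewrite dotv_rotl dot0v oppr0 ltxx.
have az : a \in top p (cls (c a)) z.
  apply/topP; split=> // x xc; have [->//|xa] := eqVneq x a.
  rewrite -subr_ge0 -dotvBr zE // mulr_ge0 ?subr_ge0 //.
    by apply: ltW; exact: pos.
  by apply: smax; apply/finset.setD1P.
exists z, q; split=> //; apply/topP; split=> // x xc.
have := zE q qc qa; rewrite subrr mulr0 dotvBr => /eqP; rewrite subr_eq0 => /eqP <-.
by case/topP: az => _; apply.
Qed.

(** Each exposed point is sent to a cell at its entry ray. If points of different classes had the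
    same image, their rays would be parallel, and one nonzero functional would be orthogonal to two
    independent edges. *)
Lemma dim2_lower_bound : (#|exposed p c| <= #|cells p c|)%N.
Proof.
have /choice [f hf] : forall a, exists f : {ffun 'I_m -> 'I_N}, a \in exposed p c ->
    [/\ f \in cells p c, f (c a) = a & exists z q, [/\ z != 0,
      forall i, f i \in top p (cls i) z, q \in top p (cls (c a)) z, q != a &
      0 < dotv (rot z) (p a - p q)]].
  move=> a; have [aE|aE] := boolP (a \in exposed p c); last by exists [ffun=> a].
  have [z [q [z0 az qz qa rz]]] := entry_ray aE.
  have [x xt] := top_point p c_gt1 z.
  have fz i : [ffun i => if i == c a then a else x i] i \in top p (cls i) z.
    by rewrite ffunE; case: eqP => [->|].
  exists [ffun i => if i == c a then a else x i] => _; split.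
  - exact: (cells_topP gen z0).
  - by rewrite ffunE eqxx.
  - by exists z, q.
rewrite -(card_in_imset (f := f) (D := mem (exposed p c))).
  by apply: subset_leq_card; apply/fintype.subsetP => x /imsetP [a /hf [fC _ _] ->].
move=> a b /hf [_ fa [z [q [z0 fz qz qa rz]]]].
move=> /hf [_ fb [z' [q' [z'0 fz' q'z q'a rz']]]] e.
have [cab|cab] := eqVneq (c a) (c b); first by rewrite -fa e cab.
(* Strictly clockwise of the entry ray [u] of [x] the tied point [y] beats [x], so a [v] at which
   [x] is maximal is not there. *)
have half u v (x y : 'I_N) (i : 'I_m) :
    x \in top p (cls i) u -> y \in top p (cls i) u ->
    u != 0 -> 0 < dotv (rot u) (p x - p y) -> x \in top p (cls i) v ->
    0 <= dotv v (rot u).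
  move=> xu yu u0 ru xv.
  have vxy : 0 <= dotv (p x - p y) v.
    by rewrite dotvC dotvBr subr_ge0; case/topP: xv => _; apply; case/topP: yu.
  have : 0 <= dotv (p x - p y) v * dotv u u.
    by rewrite mulr_ge0 // ltW // dotv_gt0.
  rewrite dotv_frame [dotv _ u]dotvC dotvBr (top_eq xu yu) subrr mul0r add0r.
  by rewrite pmulr_rge0 // dotvC.
have at_ : a \in top p (cls (c a)) z by rewrite -{1}fa.
have at' : a \in top p (cls (c a)) z' by rewrite -{1}fa e.
have bt : b \in top p (cls (c b)) z by rewrite -{1}fb -e.
have bt' : b \in top p (cls (c b)) z' by rewrite -{1}fb.
have h1 : 0 <= dotv z' (rot z) := half z z' a q (c a) at_ qz z0 rz at'.
have h2 : 0 <= dotv z (rot z') := half z' z b q' (c b) bt' q'z z'0 rz' bt.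
(* By antisymmetry of [rot], the inequalities [h1] and [h2] bound the same number from both
   sides. *)
have z'z : dotv z' (rot z) = 0.
  apply/eqP; rewrite eq_le h1 andbT -oppr_ge0 -dotv_rotl dotvC //.
have zb : dotv z (p b - p q') = 0.
  have : dotv z (p b - p q') * dotv z' z' = 0.
    rewrite dotvC dotv_frame [dotv _ z']dotvC dotvBr.
    rewrite (top_eq bt' q'z) subrr mul0r add0r.
    by rewrite [dotv z (rot z')]dotvC dotv_rotl z'z oppr0 mulr0.
  by move/eqP; rewrite mulf_eq0 (gt_eqF (dotv_gt0 z'0)) orbF => /eqP.
have za : dotv z (p a - p q) = 0.
  by rewrite dotvBr (top_eq at_ qz) subrr.
have cq : c q = c a := top_color qz; have cq' : c q' = c b := top_color q'z.
have ab : a != b by apply: contraNneq cab => ->.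
have : (#|[set a; b]%SET| < 2)%N.
  apply: (generic_ortho_card gen (r := fun x => if x == a then q else q') (y := z)) => //.
    move=> x; rewrite in_set2 => /orP [] /eqP ->;
      rewrite ?eqxx 1?(eq_sym b) ?(negPf ab) !inE negb_or.
      by rewrite qa /=; apply: contraNneq cab => <-; rewrite cq.
    by rewrite q'a andbT; apply: contraNneq cab => <-; rewrite cq'.
  by move=> x; rewrite in_set2 => /orP [] /eqP ->;
    rewrite ?eqxx 1?(eq_sym b) ?(negPf ab).
by rewrite cards2 ab.
Qed.

End dimension_two.

End low_dimension.

(** * The upper bound for segments *)

Section shattering.
Variable T : finType.
Implicit Types (F : {set {set T}}) (S A : {set T}).

Definition shattered F : {set {set T}} :=
  [set S : {set T} | [forall S' : {set T}, (S' \subset S) ==>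
     [exists A in F, A :&: S == S']]]%SET.

Lemma shatteredP F S :
  reflect (forall S', S' \subset S -> exists2 A, A \in F & (A :&: S)%SET = S')
          (S \in shattered F).
Proof.
rewrite inE; apply: (iffP forallP) => h S'.
  by move=> /(implyP (h S'))/exists_inP [A AF /eqP e]; exists A.
by apply/implyP => /h [A AF e]; apply/exists_inP; exists A => //; apply/eqP.
Qed.

Lemma shattered_notin F S x (b : bool) : (forall A, A \in F -> (x \in A) = b) ->
  S \in shattered F -> x \notin S.
Proof.
move=> Fx /shatteredP sh; apply/negP => xS.
have [|A AF e] := sh (if b then finset.set0 else [set x]%SET).
  by case: b {Fx}; rewrite ?finset.sub0set ?finset.sub1set.
have /setP /(_ x) := e; rewrite !inE xS andbT Fx //.
by case: b {Fx e}; rewrite !inE ?eqxx.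
Qed.

Lemma shattered_mono F F' : F \subset F' -> shattered F \subset shattered F'.
Proof.
move=> FF'; apply/fintype.subsetP => S /shatteredP sh; apply/shatteredP => S' /sh [A AF e].
by exists A => //; exact: (fintype.subsetP FF').
Qed.

(** Split [F] by membership of a point [x] that separates two members. Sets shattered by a half
    avoid [x], and a set [S] shattered by both halves also yields [x |: S]. *)
Lemma pajor F : (#|F| <= #|shattered F|)%N.
Proof.
have [n] := ubnP #|F|; elim: n F => // n IHn F Fn.
have [F1|] := leqP #|F| 1.
  have [->|[A AF]] := set_0Vmem F; first by rewrite cards0.
  apply: (leq_trans F1); rewrite card_gt0; apply/finset.set0Pn; exists finset.set0.
  apply/shatteredP => S'; rewrite finset.subset0 => /eqP ->.
  by exists A => //; rewrite finset.setI0.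
case/card_gt1P => A [B [AF BF AB]].
have [x xAB] : exists x, (x \in A) != (x \in B).
  apply: contrapT => no; case/eqP: AB; apply/setP => x.
  by apply/eqP; apply: contrapT => /negP h; apply: no; exists x.
pose P := [set C : {set T} | x \in C]%SET.
pose F1 := (F :&: P)%SET; pose F0 := (F :\: P)%SET.
have cF : (#|F1| + #|F0| = #|F|)%N by rewrite cardsID.
have F1n : (0 < #|F1|)%N.
  rewrite card_gt0; apply/finset.set0Pn; have [xA|xA] := boolP (x \in A).
    by exists A; rewrite !inE AF xA.
  by exists B; move: xAB; rewrite (negPf xA) !inE BF; case: (x \in B).
have F0n : (0 < #|F0|)%N.
  rewrite card_gt0; apply/finset.set0Pn; have [xA|xA] := boolP (x \in A).
    by exists B; move: xAB; rewrite xA !inE BF; case: (x \in B).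
  by exists A; rewrite !inE AF xA.
have sh1 : (#|F1| <= #|shattered F1|)%N by apply: IHn; lia.
have sh0 : (#|F0| <= #|shattered F0|)%N by apply: IHn; lia.
have x1 S : S \in shattered F1 -> x \notin S.
  by apply: (@shattered_notin _ _ _ true) => C; rewrite !inE => /andP [].
have x0 S : S \in shattered F0 -> x \notin S.
  by apply: (@shattered_notin _ _ _ false) => C; rewrite !inE => /andP [/negPf].
pose I := [set (x |: S)%SET | S in shattered F1 :&: shattered F0]%SET.
have cI : #|I| = #|(shattered F1 :&: shattered F0)%SET|.
  apply: card_in_imset => S S'; rewrite !finset.in_setI.
  move=> /andP [/x1 xS _] /andP [/x1 xS' _] e.
  by rewrite -(finset.setU1K xS) e finset.setU1K.
rewrite -cF; apply: leq_trans (leq_add sh1 sh0) _.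
(* Inclusion-exclusion, with the intersection replaced by its translate [I], whose members all
   contain [x]. *)
rewrite -cardsUI -cI -cardsUI (_ : (_ :&: I)%SET = finset.set0); last first.
  apply/setP => S; rewrite finset.in_setI finset.in_setU finset.in_set0; apply/negbTE/negP.
  move=> /andP [/orP sh /imsetP [S' _ e]].
  have : x \notin S by case: sh => [/x1|/x0].
  by rewrite e !inE eqxx.
rewrite cards0 addn0 subset_leq_card // !finset.subUset.
rewrite !shattered_mono ?finset.subsetIl ?finset.subsetDl //=.
apply/fintype.subsetP => S /imsetP [S0]; rewrite finset.in_setI => /andP [h1 h0] ->.
have xS0 := x1 _ h1; apply/shatteredP => S' sub.
have [xS'|xS'] := boolP (x \in S').
  have [|C CF e] := (shatteredP _ _ h1) (S' :\ x)%SET.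
    by rewrite finset.subDset.
  move: CF; rewrite !inE => /andP [CF xC]; exists C => //.
  by rewrite finset.setIUr e (finset.setIidPr _) ?finset.sub1set // finset.setD1K.
have [|C CF e] := (shatteredP _ _ h0) S'.
  apply/fintype.subsetP => z zS'; have := fintype.subsetP sub z zS'.
  by rewrite !inE => /orP [/eqP zx|//]; rewrite -zx zS' in xS'.
move: CF; rewrite !inE => /andP [xC CF]; exists C => //.
rewrite finset.setIUr e (_ : (C :&: [set x])%SET = finset.set0) ?finset.set0U //.
apply/setP => z; rewrite !inE; apply/negbTE/negP => /andP [zC /eqP zx].
by rewrite -zx zC in xC.
Qed.

End shattering.

(** * Sign patterns of the cells of segments *)

Section segments_upper_bound.
Context {R : realType} {d N m : nat}.
Variables (p : 'I_N -> 'rV[R]_d) (c : 'I_N -> 'I_m).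

Local Notation cls i := [set j | c j == i]%SET.
Local Notation cells := (cells p c).

Lemma linear_dependency (S : {set 'I_m}) (f : 'I_m -> 'rV[R]_d) : (d < #|S|)%N ->
  exists2 k : 'I_m -> R, \sum_(i in S) k i *: f i = 0 & exists2 i, i \in S & k i != 0.
Proof.
move=> Sd; pose A : 'M[R]_(#|S|, d) := \matrix_i f (enum_val i).
have : kermx A != 0.
  rewrite kermx_eq0; apply/negP => /eqP rk.
  by have := rank_leq_col A; rewrite rk leqNgt Sd.
move=> /rowV0Pn [v /sub_kermxP vA /eqP v0].
have [j vj] : exists j, v ord0 j != 0.
  apply: contrapT => no; apply: v0; apply/rowP => j; rewrite mxE.
  by apply: contrapT => /eqP vj; apply: no; exists j.
pose k i := if [pick l : 'I_#|S| | enum_val l == i] is Some l then v ord0 l else 0.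
have kE l : k (enum_val l) = v ord0 l.
  by rewrite /k; case: pickP => [l' /eqP/enum_val_inj -> //|/(_ l)]; rewrite eqxx.
exists k; last by exists (enum_val j); rewrite ?enum_valP // kE.
rewrite big_enum_val /= -[RHS]vA mulmx_sum_row; apply: eq_bigr => l _.
by rewrite kE rowK.
Qed.

Hypothesis c_eq2 : forall i, #|cls i| = 2.
Variable m0 : 'I_m.

Lemma cell_color (x : {ffun 'I_m -> 'I_N}) i : x \in cells -> x i \in cls i.
Proof. by case/cellsP => y /(_ i) /top1P []. Qed.

(** [pajor] is applied to the sign patterns of these cells. A shattered set of size at least [d],
    enlarged by [m0], carries a linear relation between edges; a cell whose signs match the
    coefficients turns it into a vanishing sum of nonnegative terms. *)
Lemma half_cells_upper_bound e : e \in cls m0 ->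
  (#|[set x in cells | x m0 == e]%SET| <= \sum_(k < d) 'C(m - 1, k))%N.
Proof.
move=> ec.
have /choice [ab hab] : forall i, exists z : 'I_N * 'I_N,
    z.1 != z.2 /\ cls i = [set z.1; z.2]%SET.
  move=> i; have /cards2P [a [b [ab ci]]] : #|cls i| == 2 by rewrite c_eq2.
  by exists (a, b).
have [e' ee' e'c] : exists2 e', e' != e & e' \in cls m0.
  have /cards2P [a [b [abn ci]]] : #|cls m0| == 2 by rewrite c_eq2.
  have [ea|ea] := eqVneq a e; [exists b | exists a]; rewrite // ?ci ?in_set2 ?eqxx ?orbT //.
  by rewrite -ea eq_sym.
pose a i := (ab i).1; pose b i := (ab i).2.
have clsab i x : x \in cls i -> x = a i \/ x = b i.
  by have [_ ->] := hab i; rewrite in_set2 => /orP [] /eqP ->; [left|right].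
pose X := [set x in cells | x m0 == e]%SET; rewrite -/X.
pose sgn (x : {ffun 'I_m -> 'I_N}) := [set i | (i != m0) && (x i == a i)]%SET.
have XP x : x \in X -> x \in cells /\ x m0 = e by rewrite inE => /andP [xC /eqP].
have sgn_inj : {in X &, injective sgn}.
  move=> x y /XP [xC xe] /XP [yC ye] /setP sxy.
  apply/ffunP => i; have [->|im] := eqVneq i m0; first by rewrite xe ye.
  have := sxy i; rewrite !inE im /=.
  have [->|->] := clsab i _ (cell_color i xC); have [->|->] := clsab i _ (cell_color i yC);
    rewrite ?eqxx // => h; first [by have /eqP -> := esym h | by have /eqP -> := h].
rewrite -(card_in_imset sgn_inj); apply: (leq_trans (pajor _)).
have <- : #|~: [set m0]%SET| = (m - 1)%N by rewrite cardsC1 card_ord subn1.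
rewrite -card_small_subsets; apply: subset_leq_card.
apply/fintype.subsetP => S Ssh.
have mS : m0 \notin S.
  apply: (shattered_notin (b := false) _ Ssh) => A /imsetP [x _ ->].
  by rewrite !inE eqxx.
rewrite inE; apply/andP; split.
  by apply/fintype.subsetP => i iS; rewrite !inE; apply: contraNneq mS => <-.
rewrite ltnNge; apply/negP => dS.
pose w i := if i == m0 then p e - p e' else p (a i) - p (b i).
have [|k0 k0w [j jS k0j]] := @linear_dependency (m0 |: S)%SET w.
  by rewrite cardsU1 mS add1n ltnS.
(* At [m0] the end [e] is fixed and cannot follow the sign of the coefficient, so the relation is
   negated if necessary. *)
have [k [kw kj km]] : exists k : 'I_m -> R,
    [/\ \sum_(i in (m0 |: S)%SET) k i *: w i = 0, k j != 0 & 0 <= k m0].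
  have [km|km] := leP 0 (k0 m0); first by exists k0.
  exists (fun i => - k0 i); rewrite oppr_eq0 oppr_ge0; split=> //; last exact: ltW.
  under eq_bigr => i _ do rewrite scaleNr.
  by rewrite sumrN k0w oppr0.
have [|A /imsetP [x xX ->] eS] := (shatteredP _ _ Ssh) [set i in S | 0 < k i]%SET.
  by apply/fintype.subsetP => i; rewrite inE => /andP [].
have [xC xe] := XP _ xX.
have [y hy] := cellsP _ _ _ xC.
have lt_y i z : z \in cls i -> z != x i -> 0 < dotv y (p (x i) - p z).
  by move=> zc zx; rewrite dotvBr subr_gt0; have [_] := (top1P p _ _ _).1 (hy i); apply.
have ac i : a i \in cls i by have [_ ->] := hab i; rewrite in_set2 eqxx.
have bc i : b i \in cls i by have [_ ->] := hab i; rewrite in_set2 eqxx orbT.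
have ab_ i : a i != b i by have [] := hab i.
have terms i : i \in (m0 |: S)%SET -> 0 <= k i * dotv y (w i) /\
    (k i * dotv y (w i) = 0 -> k i = 0).
  move=> iS; rewrite /w; have [im|im] := eqVneq i m0.
    have pos : 0 < dotv y (p e - p e') by rewrite -xe; apply: lt_y; rewrite ?xe.
    rewrite im; split; first by rewrite mulr_ge0 // ltW.
    by move/eqP; rewrite mulf_eq0 (gt_eqF pos) orbF => /eqP.
  have {}iS : i \in S by move: iS; rewrite in_setU1 (negPf im).
  have := congr1 (fun A : {set 'I_m} => i \in A) eS; rewrite !inE im iS !andbT /=.
  have [xa|xb] := clsab i _ (cell_color i xC).
    have pos : 0 < dotv y (p (a i) - p (b i)).
      by rewrite -xa; apply: lt_y; rewrite ?xa // eq_sym.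
    rewrite xa eqxx => /esym kpos; split; first by rewrite mulr_ge0 // ltW.
    by move/eqP; rewrite mulf_eq0 (gt_eqF pos) orbF => /eqP.
  have neg : dotv y (p (a i) - p (b i)) < 0.
    by rewrite -oppr_gt0 -dotvNr opprB -xb; apply: lt_y; rewrite ?xb.
  rewrite xb eq_sym (negPf (ab_ i)) => /esym/negbT; rewrite -leNgt => kneg.
  split; first by rewrite mulr_le0 // ltW.
  by move/eqP; rewrite mulf_eq0 (lt_eqF neg) orbF => /eqP.
have : \sum_(i in (m0 |: S)%SET) k i * dotv y (w i) = 0.
  by rewrite -[RHS](dotv0 y) -kw dotv_sumr; apply: eq_bigr => i _; rewrite dotvZr.
move=> /psumr_eq0P h; have := h (fun i iS => (terms i iS).1) j jS.
by move=> /(terms j jS).2 kj0; rewrite kj0 eqxx in kj.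
Qed.

Lemma cells_upper_bound : (#|cells| <= 2 * \sum_(k < d) 'C(m - 1, k))%N.
Proof.
have /cards2P [a [b [ab ci]]] : #|cls m0| == 2 by rewrite c_eq2.
have aC : a \in cls m0 by rewrite ci in_set2 eqxx.
have bC : b \in cls m0 by rewrite ci in_set2 eqxx orbT.
apply: leq_trans (_ : (#|[set x in cells | x m0 == a]%SET| +
                       #|[set x in cells | x m0 == b]%SET|) <= _)%N.
  rewrite -cardsUI; apply: leq_trans (leq_addr _ _); apply: subset_leq_card.
  apply/fintype.subsetP => x xC; rewrite finset.in_setU.
  rewrite [x \in [set _ in _ | _]]inE [X in _ || X]inE xC /=.
  by have := cell_color m0 xC; rewrite ci in_set2.
by rewrite mul2n -addnn leq_add // half_cells_upper_bound.
Qed.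

Lemma segments_exposed : generic p -> (0 < d)%N -> exposed p c = [set: 'I_N]%SET.
Proof.
move=> gen d0; apply/setP => x; rewrite finset.in_setT inE; apply/asboolP.
have xc : x \in cls (c x) by rewrite inE.
have [b bx ci] : exists2 b, x != b & cls (c x) = [set x; b]%SET.
  have /cards2P [a [b [ab ci]]] : #|cls (c x)| == 2 by rewrite c_eq2.
  move: xc; rewrite ci in_set2 => /orP [] /eqP ->; first by exists b.
  by exists a; [rewrite eq_sym | rewrite finset.setUC].
exists (p x - p b); apply/top1P; split=> // z.
rewrite ci in_set2 => /orP [/eqP -> |/eqP -> _].
  by rewrite eqxx.
rewrite -subr_gt0 -dotvBr dotv_gt0 // subr_eq0.
by apply: contra bx => /eqP/(generic_inj gen d0) ->.
Qed.

End segments_upper_bound.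

(** * Vertices of polytopes and of their sum *)

Section polytope_vertices.
Context {R : realType} {d N : nat}.
Variable p : 'I_N -> 'rV[R]_d.
Implicit Types (B : {set 'I_N}) (y x : 'rV[R]_d).
Local Open Scope classical_set_scope.

Lemma conv_hull_point B a : a \in B -> conv_hull B p (p a).
Proof.
move=> aB; exists (fun j => (j == a)%:R); split.
- by move=> j _; exact: ler0n.
- by rewrite (bigD1 a) //= eqxx big1 ?addr0 // => j /andP [_ /negPf ->].
- rewrite (bigD1 a) //= eqxx scale1r big1 ?addr0 // => j /andP [_ /negPf ->].
  by rewrite scale0r.
Qed.

Lemma conv_hull_segment B a b (t : R) : a \in B -> b \in B -> a != b ->
  0 <= t <= 1 -> conv_hull B p ((1 - t) *: p a + t *: p b).
Proof.
move=> aB bB ab /andP [t0 t1].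
exists (fun j => if j == a then 1 - t else if j == b then t else 0).
have ba : b != a by rewrite eq_sym.
split.
- by move=> j _; case: ifP => _; [rewrite subr_ge0 | case: ifP].
- rewrite (bigD1 a) //= eqxx (bigD1 b) /= ?bB ?ba // (negPf ba) eqxx big1 ?addr0 ?subrK //.
  by move=> j /andP [/andP [_ /negPf ->] /negPf ->].
- rewrite (bigD1 a) //= eqxx (bigD1 b) /= ?bB ?ba // (negPf ba) eqxx big1 ?addr0 //.
  by move=> j /andP [/andP [_ /negPf ->] /negPf ->]; rewrite scale0r.
Qed.

Lemma conv_hull_le B a x y : a \in top p B y -> conv_hull B p x ->
  dotv y x <= dotv y (p a).
Proof.
move=> /topP [aB ha] [k [k0 k1 ->]]; rewrite dotv_sumr.
rewrite -[leRHS]mul1r -k1 mulr_suml; apply: ler_sum => j jB.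
by rewrite dotvZr ler_wpM2l ?k0 ?ha.
Qed.

(** In a convex combination that attains the maximum, every strictly lower point has weight zero. *)
Lemma conv_hull_eq B a x y : top p B y = [set a]%SET -> conv_hull B p x ->
  dotv y x = dotv y (p a) -> x = p a.
Proof.
move=> ta [k [k0 k1 xE]] e; have [aB ha] := (top1P p _ _ _).1 ta.
have terms : \sum_(j in B) k j * dotv y (p a - p j) = 0.
  transitivity (\sum_(j in B) (k j * dotv y (p a) - dotv y (k j *: p j))).
    by apply: eq_bigr => j _; rewrite dotvBr mulrBr dotvZr.
  by rewrite sumrB -mulr_suml k1 mul1r -dotv_sumr -xE e subrr.
have nonneg j : j \in B -> 0 <= k j * dotv y (p a - p j).
  move=> jB; rewrite mulr_ge0 ?k0 // dotvBr subr_ge0.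
  by have [->//|ja] := eqVneq j a; apply/ltW/ha.
have kz j : j \in B -> j != a -> k j = 0.
  move=> jB ja; have /eqP := psumr_eq0P nonneg terms jB.
  rewrite mulf_eq0 => /orP [/eqP //|/eqP]; rewrite dotvBr => /eqP.
  by rewrite subr_eq0 eq_sym lt_eqF // ha.
rewrite xE (bigD1 a) //= big1 ?addr0 => [|j /andP [jB ja]]; last first.
  by rewrite kz // scale0r.
move: k1; rewrite (bigD1 a) //= big1 ?addr0 => [->|j /andP [jB ja]]; last exact: kz.
by rewrite scale1r.
Qed.

Hypothesis p_inj : injective p.

Lemma vertices_conv_hull B v0 : v0 \in B ->
  vertices (conv_hull B p) =
  [set p a | a in [set a | exists y, top p B y = [set a]%SET]].
Proof.
move=> v0B; apply/seteqP; split=> v.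
  move=> [Pv [y hy]]; have [a at_] := top_witness p y v0B.
  have aB : a \in B by case/topP: at_.
  have pav b : b \in top p B y -> p b = v.
    move=> bt; have Pb := conv_hull_point (fintype.subsetP (top_sub _ _ _) b bt).
    apply/eqP; apply: contraT => /(hy _ Pb).
    by rewrite ltNge (conv_hull_le bt Pv).
  exists a; last exact: pav.
  exists y; apply/setP => b; rewrite finset.in_set1; apply/idP/eqP => [bt|->//].
  by apply: p_inj; rewrite !pav.
move=> [a [y ta] <-]; have [aB ha] := (top1P p _ _ _).1 ta.
split; first exact: conv_hull_point.
exists y => w Pw wa; rewrite lt_neqAle (conv_hull_le _ Pw) ?andbT; last by rewrite ta set11.
by apply: contra wa => /eqP /(conv_hull_eq ta Pw) ->.
Qed.

Lemma mComp_image (T : finType) (X : {set T}) (f : T -> 'rV[R]_d) (P : set 'rV[R]_d) :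
  {in X &, injective f} -> vertices P = [set f x | x in [set x | x \in X]] ->
  mComp P = #|X|.
Proof.
move=> finj vP; rewrite /mComp vP.
have -> : [set f x | x in [set x | x \in X]] = [set` [fset f x | x in X]%fset].
  apply/seteqP; split=> z /=.
    by move=> [x xX <-]; apply/imfsetP; exists x.
  by move=> /imfsetP [x /= xX ->]; exists x.
by rewrite set_fsetK card_in_imfset //= cardE; congr size.
Qed.

Variables (m : nat) (c : 'I_N -> 'I_m).
Local Notation cls i := [set j | c j == i]%SET.
Hypothesis c_gt1 : forall i, (1 < #|cls i|)%N.
Local Notation P := (fun i : 'I_m => conv_hull (cls i) p).

Lemma mComp_conv_hull i : mComp (P i) = #|[set a in exposed p c | c a == i]%SET|.
Proof.
have /card_gt0P [v0 v0c] := ltnW (c_gt1 i).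
apply: (mComp_image (f := p)); first by move=> x y _ _; exact: p_inj.
rewrite (vertices_conv_hull v0c); congr (_ @` _); apply/seteqP; split=> a /=.
  move=> [y ta]; have [aB _] := (top1P p _ _ _).1 ta.
  rewrite inE in aB; rewrite !inE aB andbT; apply/asboolP; exists y.
  by rewrite (eqP aB).
rewrite !inE => /andP [/asboolP [y ta] /eqP ca]; exists y.
by rewrite -ca.
Qed.

Lemma sum_mComp : (\sum_(i < m) mComp (P i))%N = #|exposed p c|.
Proof.
rewrite -sum1_card (partition_big c xpredT) //=; apply: eq_bigr => i _.
by rewrite mComp_conv_hull -sum1_card; apply: eq_bigl => a; rewrite inE.
Qed.

(** Maxima add up over the summands. If [y] exposes a single point of the sum, exchanging one
    summand for another maximizer leaves the sum unchanged, so by cancellation each summand has one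
    maximizer. *)
Lemma vertices_minkowski_sum :
  vertices (minkowski_sum P) =
  [set \sum_(i < m) p (x i) | x in [set x | x \in cells p c]].
Proof.
apply/seteqP; split=> v.
  move=> [[q Pq vE] [y hy]].
  have /choice [x hx] : forall i, exists a, a \in top p (cls i) y.
    by move=> i; have /card_gt0P [v0 v0c] := ltnW (c_gt1 i); exact: top_witness v0c.
  have sumE (z : 'I_m -> 'I_N) : (forall i, z i \in top p (cls i) y) ->
      \sum_(i < m) p (z i) = v.
    move=> hz; apply/eqP; apply: contraT => /hy.
    have zP : minkowski_sum P (\sum_(i < m) p (z i)).
      exists (fun i => p (z i)) => // i; apply: conv_hull_point.
      exact: (fintype.subsetP (top_sub _ _ _) _ (hz i)).
    move=> /(_ zP); rewrite vE ltNge !dotv_sumr => /negP; case.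
    by apply: ler_sum => i _; exact: conv_hull_le (hz i) (Pq i).
  exists [ffun i => x i]; last first.
    by rewrite -(sumE x hx); apply: eq_bigr => i _; rewrite ffunE.
  apply/cellsP; exists y => i; rewrite ffunE; apply/setP => b; rewrite finset.in_set1.
  apply/idP/eqP => [bt|->//].
  have := sumE (fun j => if j == i then b else x j); rewrite -(sumE x hx).
  rewrite (bigD1 i) //= eqxx [in RHS](bigD1 i) //=.
  rewrite (eq_bigr (fun j => p (x j))) => [h|j /negPf -> //].
  by apply/p_inj/(addIr _)/h => j; case: eqP => [->|_].
move=> [x /cellsP [y hy] <-].
have xt i : x i \in top p (cls i) y by rewrite hy set11.
split.
  exists (fun i => p (x i)) => // i; apply: conv_hull_point.
  exact: (fintype.subsetP (top_sub _ _ _) _ (xt i)).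
exists y => w [q Pq ->] qx; rewrite !dotv_sumr.
rewrite lt_neqAle ler_sum ?andbT; last by move=> i _; exact: conv_hull_le (xt i) (Pq i).
apply: contra qx => /eqP e; apply/eqP; apply: eq_bigr => i _.
apply: (conv_hull_eq (hy i) (Pq i)).
have : \sum_(j < m) (dotv y (p (x j)) - dotv y (q j)) = 0 by rewrite sumrB e subrr.
move=> /psumr_eq0P h; apply/esym/eqP; rewrite -subr_eq0; apply/eqP; apply: h => // j _.
by rewrite subr_ge0; exact: conv_hull_le (xt j) (Pq j).
Qed.

(** The functional exposing [x] is at least as large on each summand of [x] as on that of [z]; equal
    sums force equality in each summand. *)
Lemma cells_sum_inj :
  {in cells p c &, injective (fun x : {ffun 'I_m -> 'I_N} => \sum_(i < m) p (x i))}.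
Proof.
move=> x z /cellsP [y hy] zC /= e; apply/ffunP => i.
have xt j : x j \in top p (cls j) y by rewrite hy set11.
have zc j : z j \in cls j.
  by have [y' hy'] := cellsP _ _ _ zC; have [] := (top1P p _ _ _).1 (hy' j).
have : \sum_(j < m) (dotv y (p (x j)) - dotv y (p (z j))) = 0.
  by rewrite sumrB -!dotv_sumr e subrr.
move=> /psumr_eq0P h; have [_ hx] := (top1P p _ _ _).1 (hy i).
apply/eqP; apply: contraT; rewrite eq_sym => /(hx _ (zc i)).
rewrite -subr_gt0 h ?ltxx // => j _.
by rewrite subr_ge0; have /topP [_] := xt j; apply.
Qed.

Lemma mComp_minkowski_sum : mComp (minkowski_sum P) = #|cells p c|.
Proof.
exact: (mComp_image (f := fun x : {ffun 'I_m -> 'I_N} => \sum_(i < m) p (x i))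
  cells_sum_inj vertices_minkowski_sum).
Qed.

End polytope_vertices.

(** * Convex hulls that are segments *)

Section segments.
Context {R : realType} {d N : nat}.
Variables (p : 'I_N -> 'rV[R]_d).
Implicit Types (B : {set 'I_N}).
Local Open Scope classical_set_scope.

Lemma card2_line_segment B : injective p -> #|B| = 2 -> line_segment (conv_hull B p).
Proof.
move=> p_inj B2; have /cards2P [a [b [ab BE]]] : #|B| == 2 by rewrite B2.
exists (p a), (p b); split; first by apply: contra ab => /eqP/p_inj ->.
have aB : a \in B by rewrite BE in_set2 eqxx.
have bB : b \in B by rewrite BE in_set2 eqxx orbT.
apply/seteqP; split=> x; last first.
  by move=> [t]; rewrite /= in_itv => tI <-; exact: conv_hull_segment.
have sum2 (V : nmodType) (F : 'I_N -> V) : \sum_(j in B) F j = F a + F b.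
  by rewrite BE big_setU1 ?inE //= big_set1.
move=> [k [k0 k1 ->]]; rewrite sum2 in k1; exists (k b).
  by rewrite /= in_itv /= k0 //= -k1 lerDr k0.
by rewrite sum2 -k1 addrK.
Qed.

Lemma line_segment_card2 B : generic p -> (1 < d)%N ->
  line_segment (conv_hull B p) -> (#|B| <= 2)%N.
Proof.
move=> gen d1 [u [v [_ PE]]]; rewrite leqNgt; apply/negP => /card_gt2P.
move=> [a [b [e [[aB bB eB] [ab be ea]]]]].
have seg x : x \in B -> exists t, p x = u + t *: (v - u).
  move=> xB; have := conv_hull_point p xB; rewrite PE => -[t _ <-].
  by exists t; rewrite scalerBl scale1r scalerBr addrA addrAC.
have [ta pa] := seg a aB; have [tb pb] := seg b bB; have [te pe] := seg e eB.
have diff s t : u + s *: (v - u) - (u + t *: (v - u)) = (s - t) *: (v - u).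
  by rewrite opprD addrACA subrr add0r scalerBl.
have rE x : x \in [set a; b]%SET -> e \notin [set a; b]%SET.
  by move=> _; rewrite in_set2 negb_or ea eq_sym be.
(* On a common line the two edges from [e] are multiples of [v - u]; cross-multiplying by these
   multiples gives the relation. *)
have := generic_indep gen (k := fun x => if x == a then tb - te else - (ta - te)) rE.
rewrite cards2 ab big_setU1 ?inE //= big_set1 eqxx eq_sym (negPf ab).
rewrite pa pb pe !diff !scalerA mulNr mulrC scaleNr subrr => /(_ d1 erefl) h.
have := h b; rewrite in_set2 eqxx orbT eq_sym (negPf ab) => /(_ isT) /eqP.
rewrite oppr_eq0 subr_eq0 => /eqP tae.
have ae : a = e by apply: (generic_inj gen (ltnW d1)); rewrite pa pe tae.
by rewrite ae eqxx in ea.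
Qed.

End segments.

Lemma dim1_line_segment (R : realType) (N : nat) (p : 'I_N -> 'rV[R]_1)
    (B : {set 'I_N}) :
  injective p -> (1 < #|B|)%N -> line_segment (conv_hull B p).
Proof.
move=> p_inj B1; have /card_gt0P [v0 v0B] := ltnW B1.
have [u ut] := top_witness p 1%:M v0B; have [l lt] := top_witness p (-1)%:M v0B.
have uB : u \in B by case/topP: ut.
have lB : l \in B by case/topP: lt.
have le_u x : conv_hull B p x -> x ord0 ord0 <= p u ord0 ord0.
  by move=> /(conv_hull_le ut); rewrite !dotv1E !mxE !mulr1n !mul1r.
have le_l x : conv_hull B p x -> p l ord0 ord0 <= x ord0 ord0.
  by move=> /(conv_hull_le lt); rewrite !dotv1E !mxE !mulr1n !mulN1r lerN2.
have rV1 (x z : 'rV[R]_1) : x ord0 ord0 = z ord0 ord0 -> x = z.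
  by move=> e; apply/rowP => k; rewrite (ord1 k).
have lu : l != u.
  apply/eqP => e; have /card_gt1P [a [b [aB bB ab]]] := B1.
  have pt x : x \in B -> p x = p u.
    move=> xB; have Px := conv_hull_point p xB; apply: rV1; apply: le_anti.
    by rewrite (le_u _ Px) -e (le_l _ Px).
  by case/eqP: ab; apply: p_inj; rewrite !pt.
have lt_lu : p l ord0 ord0 < p u ord0 ord0.
  rewrite lt_neqAle (le_u _ (conv_hull_point p lB)) andbT.
  by apply: contra lu => /eqP/rV1/p_inj ->.
exists (p l), (p u); split; first by apply: contra lu => /eqP/p_inj ->.
apply/seteqP; split=> x; last first.
  by move=> [t]; rewrite /= in_itv => tI <-; exact: conv_hull_segment.
move=> Px; set L := p l ord0 ord0 in lt_lu; set U := p u ord0 ord0 in lt_lu.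
have UL : 0 < U - L by rewrite subr_gt0.
exists ((x ord0 ord0 - L) / (U - L)).
  rewrite /= in_itv /=; apply/andP; split.
    by apply: divr_ge0; [rewrite subr_ge0; exact: le_l | exact: ltW].
  by rewrite ler_pdivrMr // mul1r lerD2r; exact: le_u.
apply: rV1; rewrite !mxE -/L -/U; field.
by rewrite gt_eqF.
Qed.

(** * Almost sure genericity *)

Section polynomial_functions.
Context {R : realType}.
Local Open Scope classical_set_scope.

(** Polynomial functions as a closure, so that restriction to lines and to sections goes by
    induction. *)
Inductive polyfun (n : nat) : (n.-tuple R -> R) -> Prop :=
| polyfun_cst k : polyfun (fun=> k)
| polyfun_coord i : polyfun (fun t => tnth t i)
| polyfunD f g : polyfun f -> polyfun g -> polyfun (fun t => f t + g t)
| polyfunM f g : polyfun f -> polyfun g -> polyfun (fun t => f t * g t).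

Lemma polyfun_sum n (I : Type) (s : seq I) (P : pred I) (f : I -> n.-tuple R -> R) :
  (forall i, polyfun (f i)) -> polyfun (fun t => \sum_(i <- s | P i) f i t).
Proof.
move=> pf; elim: s => [|i s IHs].
  rewrite (_ : (fun _ => _) = fun=> 0); first exact: polyfun_cst.
  by apply/funext => t; rewrite big_nil.
case Pi : (P i); last first.
  by under eq_fun do rewrite big_cons Pi.
under eq_fun do rewrite big_cons Pi.
exact: polyfunD.
Qed.

Lemma polyfun_prod n (I : Type) (s : seq I) (P : pred I) (f : I -> n.-tuple R -> R) :
  (forall i, polyfun (f i)) -> polyfun (fun t => \prod_(i <- s | P i) f i t).
Proof.
move=> pf; elim: s => [|i s IHs].
  rewrite (_ : (fun _ => _) = fun=> 1); first exact: polyfun_cst.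
  by apply/funext => t; rewrite big_nil.
case Pi : (P i); last first.
  by under eq_fun do rewrite big_cons Pi.
under eq_fun do rewrite big_cons Pi.
exact: polyfunM.
Qed.

Lemma polyfun_det n k (M : n.-tuple R -> 'M[R]_k) :
  (forall i j, polyfun (fun t => M t i j)) -> polyfun (fun t => \det (M t)).
Proof.
move=> pf; rewrite /determinant; apply: polyfun_sum => s.
by apply: polyfunM; [exact: polyfun_cst | apply: polyfun_prod].
Qed.

Lemma polyfun_section n (q : n.+1.-tuple R -> R) (x : R) :
  polyfun q -> polyfun (fun t : n.-tuple R => q [tuple of x :: t]).
Proof.
elim=> [k|i|f g _ IHf _ IHg|f g _ IHf _ IHg]; first exact: polyfun_cst.
- have [->|[j ->]] : i = ord0 \/ exists j, i = lift ord0 j.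
    by case: (unliftP ord0 i) => [j ->|->]; [right; exists j | left].
  - rewrite (_ : (fun _ => _) = fun=> x); first exact: polyfun_cst.
    by apply/funext => t; rewrite tnth0.
  - rewrite (_ : (fun _ => _) = fun t : n.-tuple R => tnth t j); first exact: polyfun_coord.
    by apply/funext => t; rewrite tnthS.
- exact: polyfunD.
- exact: polyfunM.
Qed.

Lemma polyfun_line n (q : n.+1.-tuple R -> R) (t : n.-tuple R) :
  polyfun q -> exists P : {poly R}, forall x, q [tuple of x :: t] = P.[x].
Proof.
elim=> [k|i|f g _ [P hP] _ [Q hQ]|f g _ [P hP] _ [Q hQ]].
- by exists k%:P => x; rewrite hornerC.
- have [->|[j ->]] : i = ord0 \/ exists j, i = lift ord0 j.
    by case: (unliftP ord0 i) => [j ->|->]; [right; exists j | left].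
  - by exists 'X => x; rewrite hornerX tnth0.
  - by exists (tnth t j)%:P => x; rewrite hornerC tnthS.
- by exists (P + Q) => x; rewrite hornerD hP hQ.
- by exists (P * Q) => x; rewrite hornerM hP hQ.
Qed.

Lemma finitely_many_roots (P : {poly R}) : P != 0 ->
  exists s : seq R, forall x, root P x -> x \in s.
Proof.
have [n] := ubnP (size P); elim: n P => // n IHn P Pn P0.
have [[a Pa]|noroot] := pselect (exists a, root P a); last first.
  by exists [::] => x Px; case: noroot; exists x.
have /factor_theorem [Q PQ] := Pa.
have Q0 : Q != 0 by apply: contraNneq P0 => Q0; rewrite PQ Q0 mul0r.
have [|s hs] := IHn Q _ Q0.
  by move: Pn; rewrite PQ size_Mmonic ?monicXsubC // size_XsubC addn2.
exists (a :: s) => x; rewrite PQ rootM root_XsubC inE orbC.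
by case/orP => [->//|/hs ->]; rewrite orbT.
Qed.

(* Off finitely many values of the first coordinate, the sections are null
   sets of smaller dimension. *)
Fixpoint fubini_null (n : nat) : set (n.-tuple R) -> Prop :=
  match n with
  | 0 => fun A => ~ A [tuple]
  | n'.+1 => fun A => exists s : seq R, forall x, x \notin s ->
      fubini_null [set t : n'.-tuple R | A [tuple of x :: t]]
  end.

(** On the line through [t0] in the first coordinate, [q] is a nonzero polynomial. Off its finitely
    many roots the section of [q] is nonzero at the tail of [t0], and induction applies. *)
Lemma fubini_null_polyfun n (q : n.-tuple R -> R) t0 : polyfun q -> q t0 != 0 ->
  fubini_null [set t | q t = 0].
Proof.
elim: n q t0 => [|n IHn] q t0 pq qt0.
  by rewrite /=; apply/eqP; rewrite (tuple0 t0) in qt0.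
have [P hP] := polyfun_line [tuple of behead t0] pq.
have P0 : P != 0.
  apply: contraNneq qt0 => P0; have := hP (thead t0).
  by rewrite P0 horner0 -tuple_eta => ->.
have [s hs] := finitely_many_roots P0; exists s => x xs.
apply: (IHn (fun t => q [tuple of x :: t]) [tuple of behead t0]).
  exact: polyfun_section.
by rewrite hP; apply: contra xs => /eqP e; apply: hs; apply/eqP.
Qed.

Lemma integral_finite_support (h : R -> \bar R) (s : seq R) :
  (forall x, x \notin s -> h x = 0%E) ->
  (\int[@lebesgue_measure R]_x h x = 0)%E.
Proof.
move=> hs; pose S := [set` s].
have cS (Y : set R) : countable (Y `&` S).
  by apply: finite_set_countable; apply: finite_setIr; exact: finite_seq.
have mS (Y : set R) : measurable (Y `&` S : set (measurableTypeR R)).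
  by apply: countable_measurable => //; exact: measurable_set1.
have mS' : measurable (S : set (measurableTypeR R)).
  by rewrite -(setTI S); exact: mS.
(* A preimage is a subset of the finite set [S], together with the complement of [S] when it catches
   the value 0. *)
have mh : measurable_fun setT (h : measurableTypeR R -> \bar R).
  move=> _ Y mY; rewrite setTI.
  have -> : h @^-1` Y = ((h @^-1` Y) `&` S) `|` (if `[< Y 0%E >] then ~` S else set0).
    apply/seteqP; split=> x /=.
      move=> Yx; have [xs|xs] := boolP (x \in s); first by left.
      right; case: asboolP => [_|]; first by apply/negP.
      by rewrite -(hs x xs).
    by move=> [[]//|]; case: asboolP => // Y0 /negP xs; rewrite (hs x xs).
  by apply: measurableU => //; case: ifP => _ //; exact: measurableC.
rewrite -[RHS](integral0 (@lebesgue_measure R) setT).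
apply: ae_eq_integral => //.
exists S; split=> //; first by apply: countable_lebesgue_measure0; rewrite -(setTI S).
by move=> x /= hx; apply: contrapT => /negP xs; apply: hx => _; exact: hs.
Qed.

Lemma lebesgue_int_fubini_null n (A : set (n.-tuple R))
    (g : n.-tuple (measurableTypeR R) -> \bar R) :
  fubini_null A -> (forall t, ~ A t -> g t = 0%E) -> lebesgue_int g = 0%E.
Proof.
elim: n A g => [|n IHn] A g /=; first by move=> nA gA; exact: gA.
move=> [s hs] gA; apply: (integral_finite_support (s := s)) => x xs.
by apply: (IHn _ _ (hs x xs)) => t At; exact: gA.
Qed.

Lemma measurable_polyfun n (q : n.-tuple (measurableTypeR R) -> measurableTypeR R) :
  polyfun q -> measurable_fun setT q.
Proof.
elim=> [k|i|f g _ IHf _ IHg|f g _ IHf _ IHg]; first exact: measurable_cst.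
- exact: measurable_tnth.
- exact: measurable_funD.
- exact: measurable_funM.
Qed.

Lemma ae_polyfun_neq0 n (mu : probability (n.-tuple (measurableTypeR R)) R)
    (q : n.-tuple R -> R) t0 :
  has_continuous_density mu -> polyfun q -> q t0 != 0 ->
  {ae mu, forall t, q t != 0}.
Proof.
move=> [f [_ _ fmu]] pq qt0.
have mA : measurable [set t : n.-tuple (measurableTypeR R) | q t = 0].
  rewrite (_ : [set _ | _] =
    setT `&` (q : _ -> measurableTypeR R) @^-1` [set 0]); last first.
    by rewrite setTI.
  by apply: (measurable_polyfun pq) => //; exact: measurable_set1.
exists [set t | q t = 0]; split=> //; last by move=> t /= /negP; rewrite negbK => /eqP.
rewrite fmu //; apply: lebesgue_int_fubini_null (fubini_null_polyfun pq qt0) _ => t nA.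
by rewrite indicE memNset // mulr0.
Qed.

End polynomial_functions.

Section generic_almost_everywhere.
Context {R : realType} {N d : nat}.

Lemma mul_row_widen k n (A : 'M[R]_(k, n)) (kn : (k <= n)%N) :
  row_free (\matrix_(i < k, j < k) A i (widen_ord kn j)) -> row_free A.
Proof.
move=> fr; apply: inj_row_free => v vA; apply/eqP; rewrite -(mulmx_free_eq0 _ fr).
apply/eqP/rowP => j; have := congr1 (fun B : 'rV[R]_n => B ord0 (widen_ord kn j)) vA.
rewrite !mxE => h; rewrite -[RHS]h; apply: eq_bigr => i _.
by rewrite mxE.
Qed.

(** For each of the finitely many pairs [(E, r)], row freeness follows from the nonvanishing of one
    minor, a polynomial that is not identically zero. *)
Lemma ae_generic (mu : probability ((N * d).-tuple (measurableTypeR R)) R) :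
  has_continuous_density mu ->
  {ae mu, forall t, generic (config_point t : 'I_N -> 'rV[R]_d)}.
Proof.
move=> dens.
have one (E : {set 'I_N}) (r : {ffun 'I_N -> 'I_N}) : {ae mu, forall t,
    (forall a, a \in E -> r a \notin E) -> (#|E| <= d)%N ->
    row_free (edge_mx (config_point t : 'I_N -> 'rV[R]_d) E r)}.
  have [rE|rE] := pselect (forall a, a \in E -> r a \notin E); last first.
    by apply: filterE => t /rE.
  have [Ed|Ed] := boolP (#|E| <= d)%N; last by apply: filterE => t _.
  pose M (t : (N * d).-tuple R) : 'M[R]_#|E| :=
    \matrix_(i, j) edge_mx (config_point t : 'I_N -> 'rV[R]_d) E r i (widen_ord Ed j).
  have ME t i j : M t i j = tnth t (mxvec_index (enum_val i) (widen_ord Ed j)) -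
      tnth t (mxvec_index (r (enum_val i)) (widen_ord Ed j)) by rewrite !mxE.
  (* The points of [E] are placed at distinct unit vectors and all others at the origin. As [r] maps
     [E] outside [E], the minor is the identity. *)
  pose W : 'M[R]_(N, d) := \matrix_(a, k) ((a \in E) && (index a (enum E) == k))%:R.
  pose t0 := [tuple mxvec W ord0 l | l < N * d].
  have Mt0 : M t0 = 1%:M.
    apply/matrixP => i j; rewrite ME !tnth_mktuple !mxvecE !mxE enum_valP.
    rewrite (negPf (rE _ (enum_valP i))) subr0 /=.
    by rewrite /enum_val index_uniq ?enum_uniq // -cardE ltn_ord.
  have pM : polyfun (fun t => \det (M t)).
    apply: polyfun_det => i j; under eq_fun do rewrite ME.
    apply: polyfunD; first exact: polyfun_coord.
    under eq_fun do rewrite -mulN1r.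
    by apply: polyfunM; [exact: polyfun_cst | exact: polyfun_coord].
  have Mt1 : \det (M t0) != 0 by rewrite Mt0 det1 oner_neq0.
  move: (ae_polyfun_neq0 dens pM Mt1); apply: filterS => [|t Mt _ _].
    exact: (ae_filter_ringOfSetsType mu).
  apply: (@mul_row_widen _ _ _ Ed); rewrite -/(M t) row_free_unit unitmxE unitfE.
  exact: Mt.
have : {ae mu, forall t, forall Er : {set 'I_N} * {ffun 'I_N -> 'I_N},
    (forall a, a \in Er.1 -> Er.2 a \notin Er.1) -> (#|Er.1| <= d)%N ->
    row_free (edge_mx (config_point t : 'I_N -> 'rV[R]_d) Er.1 Er.2)}.
  by apply: filter_forall => -[E r]; exact: one.
apply: filterS => t ht E r rE Ed.
have -> : edge_mx (config_point t : 'I_N -> 'rV[R]_d) E r =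
          edge_mx (config_point t) E [ffun a => r a].
  by apply/matrixP => i j; rewrite !mxE ffunE.
by apply: (ht (E, [ffun a => r a])) => // a aE; rewrite ffunE; exact: rE.
Qed.

End generic_almost_everywhere.

(** * The inequality and its equality case *)

Section vertex_count.
Context {R : realType} {d N m : nat}.
Variables (p : 'I_N -> 'rV[R]_d) (c : 'I_N -> 'I_m) (gen : generic p).

Local Notation cls i := [set j | c j == i]%SET.

Hypothesis c_gt1 : forall i, (1 < #|cls i|)%N.
Hypothesis m_gt0 : (0 < m)%N.

Lemma cells_lower_bound : (0 < d)%N ->
  (#|exposed p c| + 2 * \sum_(k < d) 'C(m - 1, k) <= #|cells p c| + 2 * m)%N.
Proof.
case: d p gen => [|[|[|d']]] // q genq _.
- have [-> ->] := dim1_cells_exposed c_gt1 genq m_gt0.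
  by rewrite big_ord1 bin0; lia.
(* For [d = 2] the binomial sum equals [m], so the two correction terms cancel. *)
- have := dim2_lower_bound c_gt1 genq.
  by rewrite !big_ord_recl big_ord0 bin0 /= bin1; lia.
- have /card_gt0P [v0 _] := ltnW (c_gt1 (Ordinal m_gt0)).
  have := @lower_bound_ge3 _ _ _ _ q c genq c_gt1 (Ordinal m_gt0) (Ordinal m_gt0) v0 false isT.
  by rewrite addn0; apply.
Qed.

Lemma cells_lower_bound_strict i : (2 < d)%N -> (1 < m)%N -> (2 < #|cls i|)%N ->
  (#|exposed p c| + 2 * \sum_(k < d) 'C(m - 1, k) < #|cells p c| + 2 * m)%N.
Proof.
move=> d2 m1 ci.
have [m0 im] : exists m0, i != m0.
  have : (1 < #|'I_m|)%N by rewrite card_ord.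
  case/card_gt1P => [j [k [_ _ jk]]]; have [ij|] := eqVneq i j; last by exists j.
  by exists k; rewrite ij.
have iS : i \in [set i; m0]%SET by rewrite in_set2 eqxx.
have mS : m0 \in [set i; m0]%SET by rewrite in_set2 eqxx orbT.
have Sd : (#|[set i; m0]%SET| < d)%N by rewrite cards2 im.
have /card_gt0P [a ac] : (0 < #|cls i|)%N := ltnW (ltnW ci).
have [y [y0 yS yi]] := ties_off_point gen iS ac ci c_gt1 Sd.
(* A tied point at [y] is taken as [a1]; a second use of [ties_off_point] gives the box without
   it. *)
have /card_gt0P [a1] := ltnW yi; rewrite in_setD1 => /andP [_ a1t].
have a1c : a1 \in cls i := fintype.subsetP (top_sub _ _ _) a1 a1t.
have [z [z0 zS zi]] := ties_off_point gen iS a1c ci c_gt1 Sd.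
have sep : box_separated p c m0 i a1.
  split=> //; [exists y | exists z]; split=> //; exact: yS || exact: zS.
have := lower_bound_ge3 (strict := true) gen c_gt1 d2 (fun=> sep).
by rewrite addn1.
Qed.

(** All [2 * m] end points are exposed, and the shattering bound on the cells meets the lower
    bound. *)
Lemma cells_segments : (0 < d)%N -> (forall i, #|cls i| = 2) ->
  (#|exposed p c| + 2 * \sum_(k < d) 'C(m - 1, k) = #|cells p c| + 2 * m)%N.
Proof.
move=> d0 c2; apply/eqP; rewrite eqn_leq cells_lower_bound //=.
rewrite (segments_exposed c2 gen d0) addnC leq_add ?(cells_upper_bound _ c2 (Ordinal m_gt0)) //.
rewrite -sum1_card (partition_big c xpredT) //= (eq_bigr (fun=> 2)) => [|i _].
  by rewrite sum_nat_const card_ord mulnC.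
rewrite -(c2 i) -[RHS]sum1_card; apply: eq_bigl => a.
by rewrite !inE.
Qed.

End vertex_count.

Lemma mComp_dim0_le1 (R : realType) (P : set 'rV[R]_0) : (mComp P <= 1)%N.
Proof.
apply: (leq_trans (n := #|` [fset (0 : 'rV[R]_0)]%fset|)); last by rewrite cardfs1.
apply: fsubset_leq_card.
by apply/fsubsetP => x _; rewrite inE thinmx0.
Qed.

Local Open Scope classical_set_scope.

(** The last implication excludes [m = 1] and [d = 2]: for a single polytope in positive dimension
    the corrections cancel and both sides agree, and in the plane the right side is the sum of the
    vertex numbers, which generic polygons attain. *)
Lemma generic_vertex_count (R : realType) (d m N : nat) (c : 'I_N -> 'I_m)
    (p : 'I_N -> 'rV[R]_d) (P := fun i => conv_hull [set j | c j == i]%SET p)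
    (lhs : int := (mComp (minkowski_sum P))%:Z)
    (rhs : int := \sum_(i < m) (mComp (P i))%:Z
                  + 2 * \sum_(k < d) 'C(m - 1, k)%:Z - 2 * m%:Z) :
  generic p -> (0 < m)%N -> (forall i, (1 < #|[set j | c j == i]%SET|)%N) ->
  [/\ rhs <= lhs, (forall i, line_segment (P i)) -> lhs = rhs &
      (1 < m)%N -> d != 2%N -> lhs = rhs -> forall i, line_segment (P i)].
Proof.
move=> gen m_gt0 c_gt1.
have rhsE : rhs = (\sum_(i < m) mComp (P i))%N%:Z
              + 2 * (\sum_(k < d) 'C(m - 1, k))%N%:Z - 2 * m%:Z.
  by rewrite !(big_morph Posz PoszD (erefl 0%:Z)).
(* In dimension 0 the binomial sum is empty and the right side is at most [m - 2 * m], hence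
   negative; segments do not exist there. *)
have [d0|d_gt0] := posnP d.
  have small : (\sum_(i < m) mComp (P i) <= m)%N.
    rewrite -[leqRHS]muln1 -[X in (_ <= X * _)%N]card_ord -sum_nat_const.
    by apply: leq_sum => i _; move: (P i); rewrite d0 => Q; exact: mComp_dim0_le1.
  have rhs_lt0 : rhs < 0.
    by rewrite rhsE; move: small; move: (\sum_(i < m) _)%N => s; rewrite d0 big_ord0; lia.
  split.
  - by apply: ltW; apply: lt_le_trans rhs_lt0 _.
  - move=> /(_ (Ordinal m_gt0)) [a [b [ab _]]].
    by case/eqP: ab; move: a b; rewrite d0 => a b; rewrite !thinmx0.
  - by move=> _ _ e; move: rhs_lt0; rewrite -e.
have p_inj := generic_inj gen d_gt0.
have {}rhsE : rhs = (#|exposed p c| + 2 * \sum_(k < d) 'C(m - 1, k))%N%:Z - 2 * m%:Z.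
  by rewrite rhsE (sum_mComp p_inj c_gt1); lia.
have lhsE : lhs = #|cells p c|%:Z by rewrite /lhs (mComp_minkowski_sum p_inj c_gt1).
have lower := cells_lower_bound gen c_gt1 m_gt0 d_gt0.
have dim1 : d = 1%N -> forall i, line_segment (P i).
  move=> d1 i; rewrite /P; move: (c_gt1 i); clear -d1 p_inj.
  by subst d; exact: dim1_line_segment.
split.
- by rewrite rhsE lhsE; lia.
- move=> seg; rewrite lhsE rhsE.
  have [d1|d1] := eqVneq d 1%N.
    have [c1 e1] : #|cells p c| = 2 /\ #|exposed p c| = (2 * m)%N.
      clear -d1 gen c_gt1 m_gt0; subst d; exact: dim1_cells_exposed.
    by rewrite c1 e1 d1 big_ord1 bin0; lia.
  have d2 : (1 < d)%N by rewrite ltn_neqAle eq_sym d1.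
  have c2 i : #|[set j | c j == i]%SET| = 2.
    by apply/eqP; rewrite eqn_leq c_gt1 (line_segment_card2 gen d2 (seg i)).
  by have := cells_segments gen c_gt1 m_gt0 d_gt0 c2; lia.
- move=> m1 dn2 e i; have [d1|d1] := eqVneq d 1%N; first exact: dim1.
  have d3 : (2 < d)%N by move: d_gt0 d1 dn2; case: (d) => [|[|[|]]].
  apply: card2_line_segment => //; apply/eqP; rewrite eqn_leq c_gt1 andbT leqNgt.
  apply/negP => ci; have := cells_lower_bound_strict gen c_gt1 d3 m1 ci.
  by move: e; rewrite lhsE rhsE; lia.
Qed.

Unset Implicit Arguments.

Theorem theorem16 (R : realType) (d m N : nat) (c : 'I_N -> 'I_m)
    (mu : probability ((N * d).-tuple (measurableTypeR R)) R)
    (m_gt0 : (0 < m)%N)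
    (c_gt1 : forall i : 'I_m, (1 < #|[set j | c j == i]%SET|)%N)
    (mu_density : has_continuous_density mu) :
  {ae mu, forall t,
    let P : 'I_m -> set 'rV[R]_d := config_polytope c t in
    let lhs : int := (mComp (minkowski_sum P))%:Z in
    let rhs : int := \sum_(i < m) (mComp (P i))%:Z
                     + 2 * \sum_(k < d) 'C(m - 1, k)%:Z - 2 * m%:Z in
    [/\ rhs <= lhs,
        (forall i, line_segment (P i)) -> lhs = rhs
      & (1 < m)%N -> d != 2%N -> lhs = rhs ->
          forall i, line_segment (P i)] }.
Proof.
move: (ae_generic mu_density); apply: filterS => t gen.
exact: generic_vertex_count gen m_gt0 c_gt1.
Qed.
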